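(* Let $d\ge 3$, $\sigma^2>0$ known, and $Z\sim N_d(\theta,\sigma^2 I_d)$ with $\theta\in\mathbb{R}^d$ unknown. Let $0\le\alpha<(d-2)/(d-1)$. Then the estimator of $\theta$ whose $i$-th component ($i=1,\dots,d$) is $$\max\left(0,\;1-\sigma^2\,\frac{2\{(d-2)-\alpha(d-1)\}}{d\,\{\max_{1\le j\le d}|z_j|\}^{2-\alpha}\,|z_i|^{\alpha}}\right)z_i$$ is minimax.
   Context: The loss of an estimator $\delta$ is $L(\delta,\theta)=\sum_{i=1}^d(\delta_i-\theta_i)^2/\sigma^2$ and its risk is $E[L(\delta(Z),\theta)]$. An estimator is minimax if it minimizes $\sup_\theta E[L(\delta(Z),\theta)]$ among all estimators. The estimator $z$ is minimax with constant risk $d$, so $\delta$ is minimax if and only if its risk is at most $d$ for every $\theta$. The estimator is defined for $z$ with all coordinates nonzero, which holds almost surely. *)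

(* Defs.v *)
From HB Require Import structures.
From mathcomp Require Import all_boot all_order all_algebra.
From mathcomp Require Import all_classical all_reals all_analysis.

Set Implicit Arguments.
Unset Strict Implicit.
Unset Printing Implicit Defensive.

Import Order.TTheory GRing.Theory Num.Theory.
Import numFieldNormedType.Exports.

Local Open Scope classical_set_scope.
Local Open Scope ring_scope.

(* R^n, with the sigma-algebra generated by the coordinates. *)
Notation vec R n := (n.-tuple (measurableTypeR R)).

Section product_probability.
Context (R : realType).

Definition cons_pair n (p : measurableTypeR R * vec R n) : vec R n.+1 :=
  [tuple of p.1 :: p.2].

Lemma measurable_cons_pair n : measurable_fun setT (@cons_pair n).
Proof. exact: (measurable_cons measurable_fst measurable_snd). Qed.

HB.instance Definition _ n :=
  isMeasurableFun.Build _ _ _ _ (@cons_pair n) (@measurable_cons_pair n).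

(* The product measure mu_0 x ... x mu_(n-1): the binary product is iterated
   along (x, v) |-> x :: v. It is characterized by tuple_prob_box below. *)
Fixpoint tuple_prob n :
    ('I_n -> probability (measurableTypeR R) R) -> probability (vec R n) R :=
  match n with
  | 0 => fun _ => \d_([tuple] : vec R 0)
  | m.+1 => fun mu =>
      distribution (mu ord0 \x tuple_prob (fun i => mu (lift ord0 i)))%E
        (@cons_pair m)
  end.

Lemma measurable_box n (A : 'I_n -> set (measurableTypeR R)) :
  (forall i, measurable (A i)) ->
  measurable [set z : vec R n | forall i, A i (tnth z i)].
Proof.
move=> mA.
rewrite (_ : [set _ | _] =
    \bigcap_(i in [set: 'I_n]) ((fun z : vec R n => tnth z i) @^-1` A i)).
  apply: fin_bigcap_measurable; first exact: finite_finset.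
  move=> i _; rewrite -[X in measurable X]setTI.
  exact: (@measurable_tnth _ (measurableTypeR R) n i measurableT _ (mA i)).
by apply/seteqP; split=> [z zA i _|z zA i]; exact: zA.
Qed.

Lemma tuple_prob_box n (mu : 'I_n -> probability (measurableTypeR R) R)
    (A : 'I_n -> set (measurableTypeR R)) :
  (forall i, measurable (A i)) ->
  tuple_prob mu [set z | forall i, A i (tnth z i)] =
  (\prod_(i < n) mu i (A i))%E.
Proof.
elim: n mu A => [|n IH] mu A mA.
  by rewrite big_ord0 /= diracE mem_set//= => -[].
rewrite big_ord_recl /= /distribution /pushforward.
have -> : @cons_pair n @^-1` [set z | forall i, A i (tnth z i)] =
    A ord0 `*` [set z | forall i, A (lift ord0 i) (tnth z i)].
  apply/seteqP; split=> [[x v] /= zA|[x v] /= [Ax Av] i].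
    split=> [|i]; first exact: (zA ord0).
    by have := zA (lift ord0 i); rewrite tnthS.
  by case: (unliftP ord0 i) => [j ->|->//]; rewrite tnthS.
rewrite product_measure1E; first last.
- exact: (measurable_box (fun i => mA _)).
- exact: mA.
congr (_ * _)%E.
exact: (IH (fun i => mu (lift ord0 i)) (fun i => A (lift ord0 i))).
Qed.

End product_probability.

Section normal_mean.
Context (R : realType) (d : nat).
Implicit Types theta z : vec R d.

(* N_d(theta, sigma^2 I_d) *)
Definition normal_vec_prob theta (sigma : R) : probability (vec R d) R :=
  tuple_prob (fun i => normal_prob (tnth theta i) sigma).

Definition loss (sigma : R) (a theta : vec R d) : R :=
  \sum_(i < d) (tnth a i - tnth theta i) ^+ 2 / sigma ^+ 2.

Section minimax.
Context (disp : measure_display) (T : measurableType disp).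
Context (P : vec R d -> probability T R) (Z : T -> vec R d) (sigma : R).

Definition risk (delta : vec R d -> vec R d) theta : \bar R :=
  ('E_(P theta)[fun w => loss sigma (delta (Z w)) theta])%E.

Definition max_risk (delta : vec R d -> vec R d) : \bar R :=
  ereal_sup [set risk delta theta | theta in [set: vec R d]].

Definition minimax (delta : vec R d -> vec R d) : Prop :=
  measurable_fun setT delta /\
  forall delta' : vec R d -> vec R d,
    measurable_fun setT delta' -> (max_risk delta <= max_risk delta')%E.

End minimax.

Definition max_abs z : R := \big[Num.max/0]_(j < d) `|tnth z j|.

(* Where z has a zero coordinate, that component of the estimate is 0. *)
Definition shrinkage_estimator (sigma alpha : R) z : vec R d :=
  [tuple Num.max 0
     (1 - sigma ^+ 2 * (2 * ((d%:R - 2) - alpha * (d%:R - 1)) /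
        (d%:R * max_abs z `^ (2 - alpha) * `|tnth z i| `^ alpha)))
     * tnth z i | i < d].

End normal_mean.

(* Main.v *)
Require Import Defs.
From HB Require Import structures.
From mathcomp Require Import all_boot all_order all_algebra.
From mathcomp Require Import all_classical all_reals all_analysis.
From mathcomp Require Import measurable_realfun zify ring lra.

Set Implicit Arguments.
Unset Strict Implicit.
Unset Printing Implicit Defensive.

Import Order.TTheory GRing.Theory Num.Theory.
Import numFieldNormedType.Exports.

Local Open Scope classical_set_scope.
Local Open Scope ring_scope.

(** The minimax risk is d, and the estimator attains it.

No estimator does better than d. Under the prior that draws the coordinates of
theta independently from N(0, r^2), the pairs (theta_i, Z_i) are independent.
Once the other coordinates are fixed, the i-th component of any estimator is
therefore an estimator of theta_i from Z_i alone, and its Bayes risk is at least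
the posterior variance s^2 r^2 / (s^2 + r^2), which tends to s^2 as r grows
(bayes_risk_ge, bayes_coordinate, minimax_lower_bound).

The risk of the estimator is at most d by Stein's method. Write the i-th
component as z_i - K_i, with
  K_i = min(1, t / w_i) z_i,  w_i = m^(2-a) |z_i|^a,  m = max_j |z_j|,
and t = 2 s^2 c / d, c = (d-2) - a(d-1). Let D_i be the derivative of K_i in
z_i. Integration by parts against the normal density gives
E[(z_i - theta_i) K_i] = s^2 E[D_i] (stein_resid, coordinate_stein), so the risk
is d + E[sum_i (K_i^2 - 2 s^2 D_i)] / s^2, and the sum is nonpositive at every z
(sum_sqr_resid_le). Indeed if m^2 <= t then K_i = z_i and D_i = 1 for all i,
while t <= 2 s^2. If m^2 > t then K_i^2 <= t^2 / m^2 for all i; D_i is at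
least (1-a) t / m^2, except at a coordinate that is the only one of maximal
modulus, where it is at least - t / m^2; so sum_i D_i >= c t / m^2, and t is the
value for which d t^2 / m^2 = 2 s^2 c t / m^2. The positive part of the
estimator enters only through the coordinates where K_i = z_i and D_i = 1.

All integrands are kept nonnegative, so that the coordinates can be separated by
Tonelli's theorem: D_i enters as D_i + 1, which is nonnegative because
|D_i| <= 1. *)

(** * Lebesgue and normal integrals on the line *)

Section line.
Context {R : realType}.
Local Notation mu := (@lebesgue_measure R).
Local Open Scope ereal_scope.

Lemma lebesgue_measure_shift (c : R) (A : set R) : measurable A ->
  pushforward mu ((fun x => x + c)%R : _ -> measurableTypeR R) A = mu A.
Proof.
have mS : measurable_fun setT ((fun x => x + c)%R : measurableTypeR R -> measurableTypeR R).
  exact: measurable_funD.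
pose S : {mfun measurableTypeR R >-> measurableTypeR R} :=
  HB.pack (fun x : measurableTypeR R => x + c : measurableTypeR R)%R
    (isMeasurableFun.Build _ _ _ _ _ mS).
move=> mA; apply/esym.
apply: (@lebesgue_measure_unique R (pushforward mu S)) => //= _ [[a b]] _ <-.
rewrite /pushforward.
have -> : S @^-1` `]a, b] = `](a - c)%R, (b - c)%R]%classic.
  by apply/seteqP; split=> x /=; rewrite !in_itv/= => /andP[? ?];
    apply/andP; split; lra.
rewrite !lebesgue_measure_itv/= !lte_fin ltrD2r.
by case: ifP => // _; rewrite -!EFinB; congr EFin; ring.
Qed.

Lemma ge0_integral_shift (c : R) (f : R -> \bar R) :
  measurable_fun [set: R] f -> (forall x, 0 <= f x) ->
  \int[mu]_x f (x + c)%R = \int[mu]_x f x.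
Proof.
move=> mf f0.
have mS : measurable_fun setT ((fun x => x + c)%R : measurableTypeR R -> measurableTypeR R).
  exact: measurable_funD.
transitivity (\int[pushforward mu
    ((fun x => x + c)%R : measurableTypeR R -> measurableTypeR R)]_x f x).
  by rewrite (ge0_integral_pushforward mS mu).
by apply: eq_measure_integral => A mA _; exact: lebesgue_measure_shift.
Qed.

Lemma ge0_integral_opp (f : R -> \bar R) :
  measurable_fun [set: R] f -> (forall x, 0 <= f x) ->
  \int[mu]_x f (- x)%R = \int[mu]_x f x.
Proof.
move=> mf f0.
have mN : measurable_fun setT (-%R : measurableTypeR R -> measurableTypeR R).
  exact: oppr_measurable.
transitivity (\int[pushforward mu
    (-%R : measurableTypeR R -> measurableTypeR R)]_x f x).
  by rewrite (ge0_integral_pushforward mN mu).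
by apply: eq_measure_integral => A mA _; exact: lebesgue_measureN.
Qed.

Lemma ge0_integral_fold (f : R -> \bar R) :
  measurable_fun [set: R] f -> (forall x, 0 <= f x) ->
  \int[mu]_x f x = \int[mu]_(x in `[0%R, +oo[) f x +
                   \int[mu]_(x in `[0%R, +oo[) f (- x)%R.
Proof.
move=> mf f0.
rewrite (@ge0_integration_by_substitution0 _ (fun x => f (- x)%R))//; last first.
  exact: measurableT_comp.
under [X in _ = _ + X]eq_integral do rewrite opprK.
rewrite -integral_itv_bndo_bndc; last exact: measurable_funS mf.
rewrite addeC -ge0_integral_setU//=.
- by congr integral; apply/seteqP; split=> // x _ /=;
    rewrite !in_itv/= andbT; case: (ltP x 0%R) => ?; [left|right].
- exact: measurable_funS mf.
- apply/disj_setPS => x /= []; rewrite !in_itv/= andbT => x0 x1.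
  by move: (lt_le_trans x0 x1); rewrite ltxx.
Qed.

End line.

Section normal_line.
Context {R : realType} (s : R).
Hypothesis s_gt0 : (0 < s)%R.
Local Notation mu := (@lebesgue_measure R).
Local Notation pdf m := (normal_pdf m s).
Local Open Scope ereal_scope.

Let s_neq0 : s != 0%R. Proof. by rewrite gt_eqF. Qed.

(** Two densities of the same measure agree almost everywhere; this identifies
    the Radon-Nikodym derivative with normal_pdf. *)
Lemma integral_normal_prob (m : R) (f : R -> \bar R) :
  measurable_fun [set: R] f -> (forall x, 0 <= f x) ->
  \int[normal_prob m s]_x f x = \int[mu]_x (f x * (pdf m x)%:E).
Proof.
move=> mf f0.
rewrite -(Radon_Nikodym_SigmaFinite.change_of_variables
  (normal_prob_dominates m s) f0 measurableT mf).
have dom := normal_prob_dominates m s.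
have int := @Radon_Nikodym_SigmaFinite.f_integrable _ _ R (normal_prob m s) mu dom.
apply: ge0_ae_eq_integral => //=.
- by apply: emeasurable_funM => //; exact: (measurable_int mu).
- apply: emeasurable_funM => //; apply/measurable_EFinP.
  exact: measurable_normal_pdf.
- by move=> x _; rewrite mule_ge0// Radon_Nikodym_SigmaFinite.f_ge0.
- by move=> x _; rewrite mule_ge0// lee_fin normal_pdf_ge0.
- apply: ae_eqe_mul2l; apply: integral_ae_eq => //=.
    by apply/measurable_EFinP; exact: measurable_normal_pdf.
  move=> E _ mE.
  by rewrite -(@Radon_Nikodym_SigmaFinite.f_integral _ _ R (normal_prob m s)).
Qed.

Lemma normal_pdf_shift (m x c : R) : normal_pdf (m + c) s (x + c) = normal_pdf m s x.
Proof.
rewrite !normal_pdfE// /normal_fun.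
by have -> : (x + c - (m + c) = x - m)%R by ring.
Qed.

Lemma normal_pdf_opp (m x : R) : normal_pdf m s (- x) = normal_pdf (- m) s x.
Proof.
rewrite !normal_pdfE// /normal_fun.
by have -> : ((- x - m) ^+ 2 = (x - - m) ^+ 2)%R by ring.
Qed.

Lemma normal_prob_shift (m c : R) (f : R -> \bar R) :
  measurable_fun [set: R] f -> (forall x, 0 <= f x) ->
  \int[normal_prob (m + c) s]_x f x = \int[normal_prob m s]_x f (x + c)%R.
Proof.
move=> mf f0.
have mfc : measurable_fun [set: R] (fun x => f (x + c)%R).
  apply: (measurableT_comp mf (_ : measurable_fun setT (fun x : R => x + c)%R)).
  exact: measurable_funD.
apply: etrans (integral_normal_prob _ mf f0) _.
apply: etrans _ (esym (integral_normal_prob m mfc (fun=> f0 _))).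
rewrite -(ge0_integral_shift c).
- by apply: eq_integral => x _; rewrite normal_pdf_shift.
- apply: emeasurable_funM => //; apply/measurable_EFinP.
  exact: measurable_normal_pdf.
- by move=> x; rewrite mule_ge0// lee_fin normal_pdf_ge0.
Qed.

Lemma is_derive_normal_pdf (m x : R) :
  is_derive x (1:R)%R (normal_pdf m s) (- ((x - m) / s ^+ 2) * normal_pdf m s x)%R.
Proof.
rewrite normal_pdfE// /normal_fun.
apply: is_derive_eq.
rewrite /GRing.scale /=.
have h : (s ^+ 2 != 0)%R by rewrite expf_neq0.
field.
by rewrite s_neq0.
Qed.

End normal_line.

(** * The fundamental theorem of calculus with integrability *)

Section has_integral.
Context {R : realType}.
Local Notation mu := (@lebesgue_measure R).
Implicit Types (A B : set R) (f g : R -> R) (v w : R).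

(** Integrability is carried along with the value so that the integrals of
    signed functions over adjacent intervals can be added. *)
Definition has_integral A f v :=
  mu.-integrable A (EFin \o f) /\ (\int[mu]_(x in A) (f x)%:E = v%:E)%E.

Lemma eq_has_integral A f g v : measurable A ->
  {in A, f =1 g} -> has_integral A f v -> has_integral A g v.
Proof.
move=> mA fg [intf vf]; split.
  by apply: eq_integrable intf => // x xA /=; rewrite fg.
by rewrite -vf; apply: eq_integral => x xA; rewrite fg.
Qed.

Lemma has_integral_setU A B f v w : measurable A -> measurable B ->
  [disjoint A & B] -> has_integral A f v -> has_integral B f w ->
  has_integral (A `|` B) f (v + w).
Proof.
move=> mA mB AB [/integrableP[mfA ifA] vA] [/integrableP[mfB ifB] vB].
have mf : measurable_fun (A `|` B) (EFin \o f) by exact/measurable_funU.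
split; last by rewrite integral_setU// vA vB.
apply/integrableP; split => //.
rewrite ge0_integral_setU//; first exact: lte_add_pinfty.
exact: measurableT_comp.
Qed.

Lemma has_integral_itv_obnd (a : R) (b : itv_bound R) f v :
  has_integral [set` Interval (BLeft a) b] f v ->
  has_integral [set` Interval (BRight a) b] f v.
Proof.
move=> [intf vf].
have intf' : mu.-integrable [set` Interval (BRight a) b] (EFin \o f).
  apply: integrableS intf => //; apply: subset_itvr.
  by rewrite bnd_simp.
split=> //; rewrite -vf integral_itv_obnd_cbnd//.
exact: measurable_int intf'.
Qed.

Lemma has_integral_itvU (a b : R) (c : itv_bound R) f v w :
  (a <= b)%R -> (BRight b <= c)%O ->
  has_integral `[a, b] f v ->
  has_integral [set` Interval (BRight b) c] f w ->
  has_integral [set` Interval (BLeft a) c] f (v + w).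
Proof.
move=> ab bc fab fbc.
rewrite (@itv_bndbnd_setU _ _ _ (BRight b))//.
apply: has_integral_setU => //.
apply/disj_setPS => x /= [].
by rewrite in_itv/= itv_boundlr => /andP[_ xb] /andP[]; rewrite bnd_simp ltNge xb.
Qed.

Lemma FTC_itv f g (a b : R) : a <= b ->
  (forall x, a <= x <= b -> is_derive x 1 g (f x)) ->
  (forall x, a <= x <= b -> {for x, continuous f}) ->
  has_integral `[a, b] f (g b - g a).
Proof.
rewrite le_eqVlt => /predU1P[-> _ _|ab dg cf].
  rewrite set_itv1 subrr; split; last by rewrite integral_set1.
  apply/integrableP; split; first exact: measurable_fun_set1.
  by rewrite integral_set1.
have cg x : a <= x <= b -> {for x, continuous g}.
  move=> /dg dgx; apply/differentiable_continuous/derivable1_diffP.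
  exact: ex_derive.
have abw : {within `[a, b], continuous f}.
  apply/continuous_within_itvP => //; split.
  - by move=> x; rewrite in_itv/= => /andP[? ?]; apply: cf; rewrite !ltW.
  - by apply: cvg_at_right_filter; apply: cf; rewrite lexx ltW.
  - by apply: cvg_at_left_filter; apply: cf; rewrite lexx ltW.
split.
  by apply: continuous_compact_integrable => //; exact: segment_compact.
rewrite (@continuous_FTC2 _ f g a b ab abw)//.
- split.
  + move=> x; rewrite in_itv/= => /andP[? ?].
    by apply: ex_derive; apply: dg; rewrite !ltW.
  + by apply: cvg_at_right_filter; apply: cg; rewrite lexx ltW.
  + by apply: cvg_at_left_filter; apply: cg; rewrite lexx ltW.
- move=> x; rewrite in_itv/= => /andP[? ?]; rewrite derive1E.
  by apply: derive_val; apply: dg; rewrite !ltW.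
Qed.

(** From N on the derivative has a constant sign, so monotone convergence gives
    its integral there, and hence its integrability. *)
Lemma FTC_itvcy f g (a N : R) : a <= N ->
  (forall x, a <= x -> is_derive x 1 g (f x)) ->
  (forall x, a <= x -> {for x, continuous f}) ->
  (forall x, N <= x -> f x <= 0) ->
  g x @[x --> +oo%R] --> (0:R) ->
  has_integral `[a, +oo[ f (- g a).
Proof.
move=> aN dg cf f0 g0.
have -> : - g a = (g N - g a) + (- g N) by ring.
apply: (has_integral_itvU aN) => //.
  by apply: FTC_itv => // x /andP[? _]; [exact: dg|exact: cf].
apply: has_integral_itv_obnd.
have cg x : a <= x -> {for x, continuous g}.
  move=> /dg dgx; apply/differentiable_continuous/derivable1_diffP.
  exact: ex_derive.
have cw : {within `[N, +oo[, continuous f}.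
  apply/continuous_within_itvcyP; split.
  - move=> x; rewrite in_itv/= andbT => Nx.
    by apply: cf; exact: le_trans (ltW Nx).
  - by apply: cvg_at_right_filter; exact: cf.
have vf : (\int[mu]_(x in `[N, +oo[) (f x)%:E = 0%:E - (g N)%:E)%E.
  apply: (@le0_continuous_FTC2y _ f g N 0) => //.
  - by apply: cvg_at_right_filter; exact: cg.
  - by move=> x Nx; apply: ex_derive; apply: dg; exact: le_trans (ltW Nx).
  - move=> x; rewrite in_itv/= andbT => Nx; rewrite derive1E.
    by apply: derive_val; apply: dg; exact: le_trans (ltW Nx).
have mf : measurable_fun `[N, +oo[ (EFin \o f).
  by apply/measurable_EFinP; exact: subspace_continuous_measurable_fun.
split; last by rewrite vf sub0e EFinN.
apply/integrableP; split => //.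
have -> : (\int[mu]_(x in `[N, +oo[) `|(EFin \o f) x| =
           \int[mu]_(x in `[N, +oo[) - (f x)%:E)%E.
  apply: eq_integral => x; rewrite inE/= in_itv/= andbT => Nx.
  by rewrite ler0_norm ?f0.
rewrite integralN; first by rewrite vf sub0e -EFinN ltry.
apply: fin_num_adde_defr.
rewrite (_ : (\int[mu]_(x in `[N, +oo[) _ = 0)%E)//.
apply: integral0_eq => x; rewrite /= in_itv/= andbT => Nx.
by rewrite funeposE; apply/max_idPr; rewrite lee_fin f0.
Qed.

End has_integral.

(** * Stein's identity on the line *)

Section stein.
Context {R : realType}.
Local Notation mu := (@lebesgue_measure R).

Lemma is_derive_continuous_for (f : R -> R) (x df : R) :
  is_derive x 1 f df -> {for x, continuous f}.
Proof.
move=> df_; apply/differentiable_continuous/derivable1_diffP.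
exact: ex_derive.
Qed.

Lemma has_integralDZ (A : set (measurableTypeR R)) (f g : R -> R) (c v w : R) :
  measurable A ->
  has_integral A f v -> has_integral A g w ->
  has_integral A (fun x => f x + c * g x) (v + c * w).
Proof.
move=> mA [intf vf] [intg vg]; have intcg := integrableZl mA c intg.
split; first by apply: eq_integrable (integrableD mA intf intcg).
under eq_integral do rewrite EFinD EFinM.
by rewrite integralD// integralZl//= vf vg.
Qed.

Lemma cvgy_le_inv (f : R -> R) (C : R) :
  (\forall x \near +oo, 0 <= f x <= C * x^-1) -> f x @[x --> +oo] --> (0 : R).
Proof.
move=> fC; apply: (squeeze_cvgr fC); first exact: cvg_cst.
rewrite -[X in _ --> X](mulr0 C); apply: cvgM; first exact: cvg_cst.
apply/gtr0_cvgV0; last exact: cvg_id.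
exact: nbhs_pinfty_gt.
Qed.

Variable s : R.
Hypothesis s_gt0 : 0 < s.
Local Notation pdf m := (normal_pdf m s).

Let s_neq0 : s != 0. Proof. by rewrite gt_eqF. Qed.
Let s2_gt0 : 0 < s ^+ 2. Proof. by rewrite exprn_gt0. Qed.

(** The derivative of K * normal_pdf m s, when D is the derivative of K. Stein's
    identity is the vanishing of its integral. *)
Definition stein (m : R) (K D : R -> R) x :=
  (D x - K x * ((x - m) / s ^+ 2)) * pdf m x.

Lemma is_derive_stein (m : R) (K D : R -> R) (x : R) : is_derive x 1 K (D x) ->
  is_derive x 1 (fun x => K x * pdf m x) (stein m K D x).
Proof.
move=> dK; have dpdf := is_derive_normal_pdf s_gt0 m x.
by apply: is_derive_eq; rewrite /stein /GRing.scale /=; ring.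
Qed.

Lemma stein_continuous (m : R) (K D : R -> R) (x : R) : is_derive x 1 K (D x) ->
  {for x, continuous D} -> {for x, continuous (stein m K D)}.
Proof.
move=> dK cD; apply: cvgM; last exact: continuous_normal_pdf.
apply: cvgB => //; apply: cvgM; first exact: is_derive_continuous_for dK.
apply: cvgM; last exact: cvg_cst.
by apply: cvgB; [exact: cvg_id|exact: cvg_cst].
Qed.

Lemma has_integral_stein (m : R) (K D : R -> R) (a b : R) : a <= b ->
  (forall x, a <= x <= b -> is_derive x 1 K (D x)) ->
  (forall x, a <= x <= b -> {for x, continuous D}) ->
  has_integral `[a, b] (stein m K D) (K b * pdf m b - K a * pdf m a).
Proof.
move=> ab dK cD; apply: (@FTC_itv _ _ (fun x => K x * pdf m x)) => // x xab.
- by apply: is_derive_stein; exact: dK.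
- by apply: stein_continuous; [exact: dK|exact: cD].
Qed.

Lemma has_integral_stein_cy (m : R) (K D : R -> R) (a N : R) : a <= N ->
  (forall x, a <= x -> is_derive x 1 K (D x)) ->
  (forall x, a <= x -> {for x, continuous D}) ->
  (forall x, N <= x -> D x <= K x * ((x - m) / s ^+ 2)) ->
  K x * pdf m x @[x --> +oo] --> (0 : R) ->
  has_integral `[a, +oo[ (stein m K D) (- (K a * pdf m a)).
Proof.
move=> aN dK cD DK K0.
apply: (@FTC_itvcy _ _ (fun x => K x * pdf m x) _ N) => // x ax.
- by apply: is_derive_stein; exact: dK.
- by apply: stein_continuous; [exact: dK|exact: cD].
- by rewrite /stein mulr_le0_ge0 ?normal_pdf_ge0// subr_le0 DK.
Qed.

(** From exp(-u) <= 1/u, the function x * normal_pdf 0 s x is O(1/x). *)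
Lemma cvg_mul_normal_pdf : x * pdf 0 x @[x --> +oo] --> (0 : R).
Proof.
apply: (@cvgy_le_inv _ (normal_peak s * (s ^+ 2 *+ 2))).
near=> x.
have x0 : 0 < x by near: x; exact: nbhs_pinfty_gt.
apply/andP; split; first by rewrite mulr_ge0 ?normal_pdf_ge0// ltW.
rewrite normal_pdfE// /normal_fun subr0 mulrCA -mulrA ler_pM2l ?normal_peak_gt0//.
rewrite mulNr expRN ler_pdivrMr ?expR_gt0//.
apply: (@le_trans _ _ ((s ^+ 2 *+ 2) * x^-1 * (x ^+ 2 / (s ^+ 2 *+ 2)))).
  rewrite le_eqVlt; apply/orP; left; apply/eqP; field.
  by rewrite s_neq0 gt_eqF.
rewrite ler_pM2l; last by rewrite mulr_gt0 ?invr_gt0// mulrn_wgt0.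
by apply: le_trans (expR_ge1Dx _); lra.
Unshelve. all: by end_near. Qed.

Lemma measurable_EFin_normal_pdf (m : R) : measurable_fun setT (EFin \o pdf m).
Proof. by apply/measurable_EFinP; exact: measurable_normal_pdf. Qed.

(** Stein's identity for K = id, on the half line because the mean is 0: the
    derivative of x * normal_pdf 0 s x is (1 - x^2/s^2) * normal_pdf 0 s x, which
    is nonpositive for x >= s, and x * normal_pdf 0 s x vanishes at 0 and at
    infinity. *)
Lemma second_moment0 : (\int[mu]_x (x ^+ 2 * pdf 0 x)%:E = (s ^+ 2)%:E)%E.
Proof.
have hG : has_integral `[0, +oo[ (stein 0 id (cst 1)) 0.
  rewrite -[X in has_integral _ _ X]oppr0 -[X in - X](mul0r (pdf 0 0)).
  apply: (@has_integral_stein_cy 0 id (cst 1) 0 s); first exact: ltW.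
  - by move=> x _; exact: cvg_cst.
  - move=> x sx; rewrite /= subr0 mulrA ler_pdivlMr// mul1r.
    by rewrite expr2 ler_pM// ltW.
  - exact: cvg_mul_normal_pdf.
have [v hv] : exists v, has_integral `[0, +oo[ (pdf 0) v.
  have i0 : mu.-integrable `[0, +oo[ (EFin \o pdf 0).
    by apply: integrableS (integrable_normal_pdf 0 s).
  exists (fine (\int[mu]_(x in `[0%R, +oo[) (pdf 0 x)%:E)%E); split=> //.
  by rewrite fineK//; exact: integrable_fin_num.
have v1 : v + v = 1.
  have := integral_normal_pdf 0 s.
  rewrite ge0_integral_fold.
  - under [X in (_ + X)%E]eq_integral do rewrite (normal_pdf_opp s_gt0) oppr0.
    by rewrite hv.2 -EFinD => -[].
  - exact: measurable_EFin_normal_pdf.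
  - by move=> x; rewrite lee_fin normal_pdf_ge0.
have hx2 : has_integral `[0, +oo[ (fun x => x ^+ 2 * pdf 0 x) (s ^+ 2 * v).
  have h0 : has_integral `[0, +oo[ (cst 0 : R -> R) 0.
    by split; [exact: integrable0|rewrite integral0].
  have h1 := has_integralDZ (s ^+ 2) (measurable_itv _) h0 hv.
  have h2 := has_integralDZ (- s ^+ 2) (measurable_itv _) h1 hG.
  rewrite mulr0 addr0 add0r in h2.
  apply: eq_has_integral h2 => // x _; rewrite /stein /=.
  by field.
rewrite ge0_integral_fold.
- under [X in (_ + X)%E]eq_integral do rewrite sqrrN (normal_pdf_opp s_gt0) oppr0.
  by rewrite hx2.2 -EFinD -mulrDr v1 mulr1.
- apply/measurable_EFinP; apply: measurable_funM => //.
  exact: measurable_normal_pdf.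
- by move=> x; rewrite lee_fin mulr_ge0 ?sqr_ge0 ?normal_pdf_ge0.
Qed.

Lemma measurable_sqrB (m : R) : measurable_fun setT (fun x : R => (x - m) ^+ 2).
Proof. by apply: measurable_funX; exact: measurable_funB. Qed.

Lemma second_moment (m : R) :
  (\int[normal_prob m s]_x ((x - m) ^+ 2)%:E = (s ^+ 2)%:E)%E.
Proof.
rewrite -second_moment0 -[X in normal_prob X s](add0r m).
rewrite (normal_prob_shift s_gt0); first last.
- by move=> x; rewrite lee_fin sqr_ge0.
- by apply/measurable_EFinP; exact: measurable_sqrB.
rewrite integral_normal_prob; first last.
- by move=> x; rewrite lee_fin sqr_ge0.
- by under eq_fun do rewrite addrK; apply/measurable_EFinP; exact: exprn_measurable.
by apply: eq_integral => x _; rewrite addrK.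
Qed.

End stein.

Lemma integral_probability_cst d (T : measurableType d) (R : realType)
  (P : probability T R) (c : \bar R) : (\int[P]_x c = c)%E.
Proof. by rewrite integral_cst// [X in (_ * X)%E]probability_setT mule1. Qed.

Section stein_pieces.
Context {R : realType} (s : R).
Hypothesis s_gt0 : 0 < s.
Local Notation pdf m := (normal_pdf m s).
Local Notation mu := (@lebesgue_measure R).

Let s_neq0 : s != 0. Proof. by rewrite gt_eqF. Qed.

Lemma eq_stein m (K D K' D' : R -> R) x :
  K x = K' x /\ D x = D' x -> stein s m K D x = stein s m K' D' x.
Proof. by rewrite /stein => -[-> ->]. Qed.

Lemma is_derive_inv (t x : R) : 0 < x ->
  is_derive x 1 (fun y => t / y) (- (t / x ^+ 2)).
Proof.
move=> x0; have xn0 : x != 0 by rewrite gt_eqF.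
have dV := @is_deriveV _ id x 1 1 xn0 (is_derive_id _ _).
apply: is_derive_eq; rewrite /GRing.scale /=.
by field.
Qed.

Lemma is_derive_cpowR (c b x : R) : 0 < x ->
  is_derive x 1 (fun y => c * y `^ b) (c * (b * x `^ (b - 1))).
Proof.
move=> x0; have dp := is_derive1_powR b x0.
by apply: is_derive_eq; rewrite /GRing.scale /=; ring.
Qed.

(** Since K is continuous, the boundary terms at p and q cancel; those at 0 and
    at infinity vanish. K is linear up to p, a power up to q, and t/x beyond. *)
Lemma has_integral_stein_pieces (m p q a b c t : R) (K D : R -> R) :
  0 < p -> p <= q -> 0 <= t ->
  a * p = c * p `^ b -> c * q `^ b = t / q ->
  (forall x, 0 <= x <= p -> K x = a * x /\ D x = a) ->
  (forall x, p < x <= q -> K x = c * x `^ b /\ D x = c * (b * x `^ (b - 1))) ->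
  (forall x, q < x -> K x = t / x /\ D x = - (t / x ^+ 2)) ->
  has_integral `[0, +oo[ (stein s m K D) 0.
Proof.
move=> p0 pq t0 acp cqt H1 H2 H3.
have q0 : 0 < q by exact: lt_le_trans pq.
rewrite [X in has_integral _ _ X](_ : 0 =
    (a * p * pdf m p - a * 0 * pdf m 0) +
    ((c * q `^ b * pdf m q - c * p `^ b * pdf m p) + - (t / q * pdf m q))).
  2: by rewrite acp cqt; ring.
apply: (has_integral_itvU (ltW p0)) => //.
  apply: eq_has_integral (has_integral_stein s_gt0 m (K := fun x => a * x)
    (D := cst a) (ltW p0) _ _) => //.
  - move=> x; rewrite inE/= in_itv/= => x0p.
    by apply/esym/eq_stein; exact: H1.
  - by move=> x _; apply: is_derive_eq; rewrite /GRing.scale/=; ring.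
  - by move=> x _; exact: cvg_cst.
rewrite (@itv_bndbnd_setU _ _ (BRight p) (BRight q))//.
apply: has_integral_setU => //.
- apply/disj_setPS => x /= [].
  by rewrite !in_itv/= andbT => /andP[_ xq]; rewrite ltNge xq.
- apply: eq_has_integral (has_integral_itv_obnd (has_integral_stein s_gt0 m
    (K := fun x => c * x `^ b) (D := fun x => c * (b * x `^ (b - 1))) pq _ _)) => //.
  + move=> x; rewrite inE/= in_itv/= => xpq.
    by apply/esym/eq_stein; exact: H2.
  + by move=> x /andP[px _]; apply: is_derive_cpowR; exact: lt_le_trans px.
  + move=> x /andP[px _]; apply: cvgM; first exact: cvg_cst.
    have x0 : 0 < x by exact: lt_le_trans px.
    exact: (is_derive_continuous_for (is_derive_cpowR b (b - 1) x0)).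
- (* Beyond q and m both terms of the derivative of t/x * pdf are nonpositive. *)
  apply: eq_has_integral (has_integral_itv_obnd (has_integral_stein_cy s_gt0
    (K := fun x => t / x) (D := fun x => - (t / x ^+ 2)) (N := Num.max q m)
    _ _ _ _ _)) => //.
  + move=> x; rewrite inE/= in_itv/= andbT => qx.
    by apply/esym/eq_stein; exact: H3.
  + by rewrite le_max lexx.
  + by move=> x qx; apply: is_derive_inv; exact: lt_le_trans qx.
  + move=> x qx; have x0 : 0 < x by exact: lt_le_trans qx.
    apply: cvgN; apply: cvgM; first exact: cvg_cst.
    apply: cvgV; first by rewrite expf_neq0// gt_eqF.
    exact: exprn_continuous.
  + move=> x; rewrite ge_max => /andP[qx mx].
    have x0 : 0 < x by exact: lt_le_trans qx.
    apply: (@le_trans _ _ 0).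
      by rewrite oppr_le0 divr_ge0// sqr_ge0.
    by rewrite mulr_ge0// divr_ge0// ?sqr_ge0 ?subr_ge0// ltW.
  + apply: (@cvgy_le_inv _ _ (t * normal_peak s)).
    near=> x; have x0 : 0 < x by near: x; exact: nbhs_pinfty_gt.
    rewrite mulr_ge0 ?normal_pdf_ge0 ?divr_ge0// ?(ltW x0)//= -mulrA.
    rewrite -mulrA ler_wpM2l// mulrC ler_wpM2r ?normal_pdf_ub//.
    by rewrite invr_ge0 ltW.
Unshelve. all: by end_near. Qed.

(** The left-hand integrand minus the right-hand one is
    2 s^2 (D - K (x - m)/s^2), so the two integrals differ by a multiple of the
    integral of stein. The half line x <= 0 is reflected: as K is odd and D even,
    this replaces m by -m. The added constant 2 s^2 makes both integrands
    nonnegative. *)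
Lemma normal_stein_identity (m C : R) (K D : R -> R) :
  measurable_fun setT K -> measurable_fun setT D ->
  (forall x, K (- x) = - K x) -> (forall x, D (- x) = D x) ->
  (forall x, K x ^+ 2 <= C) -> (forall x, `|D x| <= 1) ->
  (forall m, has_integral `[0, +oo[ (stein s m K D) 0) ->
  (\int[normal_prob m s]_x ((x - m - K x) ^+ 2 + 2 * s ^+ 2 * (D x + 1))%:E =
   \int[normal_prob m s]_x ((x - m) ^+ 2 + K x ^+ 2 + 2 * s ^+ 2)%:E)%E.
Proof.
move=> mK mD Kodd Deven KC D1 steinKD.
pose P m x := (x - m - K x) ^+ 2 + 2 * s ^+ 2 * (D x + 1).
pose Q m x := (x - m) ^+ 2 + K x ^+ 2 + 2 * s ^+ 2.
have mP k : measurable_fun setT (P k).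
  apply: measurable_funD.
    by apply: measurable_funX; apply: measurable_funB => //; exact: measurable_funB.
  by apply: measurable_funM => //; exact: measurable_funD.
have mQ k : measurable_fun setT (Q k).
  apply: measurable_funD => //; apply: measurable_funD.
    exact: measurable_sqrB.
  exact: measurable_funX.
have P0 k x : 0 <= P k x.
  have D0 : 0 <= D x + 1 by have := D1 x; rewrite ler_norml => /andP[? _]; lra.
  by rewrite /P addr_ge0 ?sqr_ge0// mulr_ge0// mulr_ge0// sqr_ge0.
have Q0 k x : 0 <= Q k x by rewrite /Q !addr_ge0 ?sqr_ge0// mulr_ge0 ?sqr_ge0.
have intQ k : mu.-integrable setT (EFin \o (fun x => Q k x * pdf k x)).
  have mQpdf : measurable_fun setT (fun x => Q k x * pdf k x).
    by apply: measurable_funM => //; exact: measurable_normal_pdf.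
  apply/integrableP; split; first exact/measurable_EFinP.
  under eq_integral do
    rewrite /= ger0_norm ?mulr_ge0 ?normal_pdf_ge0// EFinM.
  rewrite -(integral_normal_prob s k); last 2 first.
  - exact/measurable_EFinP.
  - by move=> x; rewrite lee_fin.
  apply: (@le_lt_trans _ _ (\int[normal_prob k s]_x
    (((x - k) ^+ 2)%:E + (C + 2 * s ^+ 2)%:E))%E).
    apply: ge0_le_integral => //.
    - by move=> x _; rewrite lee_fin.
    - by apply/measurable_EFinP; exact: mQ.
    - apply: emeasurable_funD => //.
      by apply/measurable_EFinP; exact: measurable_sqrB.
    - by move=> x _; rewrite lee_fin /Q -addrA lerD2l lerD2r.
  have C0 : 0 <= C by apply: le_trans (KC 0); exact: sqr_ge0.
  rewrite ge0_integralD//.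
  - rewrite (second_moment s_gt0) (integral_probability_cst (normal_prob k s)).
    by rewrite -EFinD ltry.
  - by move=> x _; rewrite lee_fin sqr_ge0.
  - by apply/measurable_EFinP; exact: measurable_sqrB.
  - by move=> x _; rewrite lee_fin addr_ge0// mulr_ge0// sqr_ge0.
(* k stands for m on the right half line and for -m on the reflected one. *)
have half k : (\int[mu]_(x in `[0%R, +oo[) (P k x * pdf k x)%:E =
               \int[mu]_(x in `[0%R, +oo[) (Q k x * pdf k x)%:E)%E.
  have iQ : mu.-integrable `[0, +oo[ (EFin \o (fun x => Q k x * pdf k x)).
    exact: integrableS (intQ k).
  have [iS vS] := steinKD k.
  transitivity (\int[mu]_(x in `[0%R, +oo[)
      ((Q k x * pdf k x)%:E + (2 * s ^+ 2)%:E * (stein s k K D x)%:E))%E.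
    apply: eq_integral => x _; rewrite -EFinM -EFinD; congr EFin.
    by rewrite /P /Q /stein; field.
  rewrite integralD//; last exact: integrableZl.
  by rewrite integralZl// vS mule0 adde0.
change (\int[normal_prob m s]_x (P m x)%:E =
        \int[normal_prob m s]_x (Q m x)%:E)%E.
rewrite integral_normal_prob; last 2 first.
- by apply/measurable_EFinP; exact: mP.
- by move=> x; rewrite lee_fin.
rewrite integral_normal_prob; last 2 first.
- by apply/measurable_EFinP; exact: mQ.
- by move=> x; rewrite lee_fin.
have m_pdf (f : R -> R) k : measurable_fun setT f ->
    measurable_fun setT (fun x => (f x)%:E * (pdf k x)%:E)%E.
  move=> mf; apply: emeasurable_funM; first exact/measurable_EFinP.
  exact: measurable_EFin_normal_pdf.
have opp_pdf (F : R -> R -> R) : (forall k x, F k (- x) = F (- k) x) ->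
    (\int[mu]_(x in `[0%R, +oo[) ((F m (- x))%:E * (pdf m (- x))%:E) =
     \int[mu]_(x in `[0%R, +oo[) (F (- m) x * pdf (- m) x)%:E)%E.
  move=> Fopp; apply: eq_integral => x _.
  by rewrite Fopp (normal_pdf_opp s_gt0).
rewrite ge0_integral_fold; last 2 first.
- exact: m_pdf (mP m).
- by move=> x; rewrite -EFinM lee_fin mulr_ge0 ?normal_pdf_ge0.
rewrite [RHS]ge0_integral_fold; last 2 first.
- exact: m_pdf (mQ m).
- by move=> x; rewrite -EFinM lee_fin mulr_ge0 ?normal_pdf_ge0.
congr (_ + _)%E; first exact: half.
rewrite (opp_pdf P); last by move=> k x; rewrite /P Kodd Deven; ring.
rewrite (opp_pdf Q); last by move=> k x; rewrite /Q Kodd; ring.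
exact: half.
Qed.

End stein_pieces.

(** * The shrinkage rule in one coordinate *)

Section shrinkage_coordinate.
Context {R : realType}.
Variables (t a : R).
Hypotheses (t_gt0 : 0 < t) (a_ge0 : 0 <= a) (a_lt1 : a < 1).
Implicit Types M x : R.

(** M is the largest modulus among the other coordinates and x the coordinate
    itself; Num.max M `|x| is then max_j |z_j|. *)
Definition weight M x := Num.max M `|x| `^ (2 - a) * `|x| `^ a.

Definition shrink M x := Num.max 0 (1 - t / weight M x) * x.

Definition resid M x := x - shrink M x.

(** The derivative of resid in x. Where it jumps the larger one-sided value is
    taken, also at |x| = M, so that at most one coordinate of a vector has a negative
    derivative even when the maximal modulus is attained several times. *)
Definition dresid M x :=
  if weight M x <= t then 1 else
  if `|x| <= M then (1 - a) * (t / weight M x) else - (t / x ^+ 2).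

Lemma powR2 x : 0 <= x -> x `^ 2 = x ^+ 2.
Proof. by move=> x0; rewrite -powR_mulrn. Qed.

Lemma mul_powRB_powR x (b : R) : 0 <= x -> b != 0 -> x `^ (b - a) * x `^ a = x `^ b.
Proof. by move=> x0 b0; rewrite -powRD subrK// (negbTE b0). Qed.

Lemma weight_ge0 M x : 0 <= weight M x.
Proof. by rewrite mulr_ge0 ?powR_ge0. Qed.

Lemma weight_le M x : weight M x <= Num.max M `|x| ^+ 2.
Proof.
have m0 : 0 <= Num.max M `|x| by rewrite le_max normr_ge0 orbT.
rewrite -powR2// -(@mul_powRB_powR _ 2)// ler_wpM2l ?powR_ge0//.
by rewrite ge0_ler_powR ?nnegrE// le_max lexx orbT.
Qed.

(** This is m |x| <= m^(2-a) |x|^a, which holds because |x| <= m and 1 - a >= 0. It is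
    what bounds resid by t/m. *)
Lemma weight_ge M x : Num.max M `|x| * `|x| <= weight M x.
Proof.
have m0 : 0 <= Num.max M `|x| by rewrite le_max normr_ge0 orbT.
rewrite -[X in X * _](powRr1 m0) -[X in _ * X](powRr1 (normr_ge0 x)).
rewrite -(@mul_powRB_powR `|x| 1)// /weight [leLHS]mulrA ler_wpM2r ?powR_ge0//.
have -> : 2 - a = 1 + (1 - a) by ring.
rewrite (@powRD _ _ 1 (1 - a)); last first.
  by apply/implyP => /eqP; move: a_lt1; lra.
rewrite ler_wpM2l ?powR_ge0// ge0_ler_powR ?nnegrE ?subr_ge0 ?(ltW a_lt1)//.
by rewrite le_max lexx orbT.
Qed.

Lemma sqr_le_weight M x : x ^+ 2 <= weight M x.
Proof.
apply: le_trans (weight_ge M x).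
by rewrite -real_normK ?num_real// expr2 ler_wpM2r// le_max lexx orbT.
Qed.

Lemma weight_far M x : M <= `|x| -> weight M x = x ^+ 2.
Proof.
move=> Mx; rewrite /weight (max_idPr Mx) mul_powRB_powR//.
by rewrite powR2// real_normK ?num_real.
Qed.

Lemma weight_opp M x : weight M (- x) = weight M x.
Proof. by rewrite /weight normrN. Qed.

Lemma residE M x : resid M x = if weight M x <= t then x else t / weight M x * x.
Proof.
rewrite /resid /shrink; case: ifPn => [wt|]; last first.
  rewrite -ltNge => tw; rewrite max_r; first by ring.
  by rewrite subr_ge0 ler_pdivrMr ?mul1r ?(ltW tw)// (lt_trans t_gt0).
have [w0|w0] := eqVneq (weight M x) 0.
  have : x ^+ 2 <= 0 by rewrite -w0 sqr_le_weight.
  rewrite le_eqVlt [_ < 0]ltNge sqr_ge0 orbF sqrf_eq0 => /eqP ->.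
  by rewrite mulr0 subr0.
have wp : 0 < weight M x by rewrite lt_neqAle eq_sym w0 weight_ge0.
rewrite max_l ?mul0r ?subr0// subr_le0 ler_pdivlMr// mul1r//.
Qed.

Lemma resid_opp M x : resid M (- x) = - resid M x.
Proof. by rewrite !residE weight_opp; case: ifP => _ //; rewrite mulrN. Qed.

Lemma dresid_opp M x : dresid M (- x) = dresid M x.
Proof. by rewrite /dresid weight_opp normrN sqrrN. Qed.

Lemma sqr_resid_le M x : resid M x ^+ 2 <= t.
Proof.
rewrite residE; case: ifPn => [|]; first exact: le_trans (sqr_le_weight _ _).
rewrite -ltNge => tw; have wp := lt_trans t_gt0 tw.
rewrite exprMn expr_div_n; set w := weight M x in tw wp *.
apply: (@le_trans _ _ (t ^+ 2 / w ^+ 2 * w)).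
  by rewrite ler_wpM2l ?sqr_le_weight// divr_ge0 ?sqr_ge0.
have -> : t ^+ 2 / w ^+ 2 * w = t * (t / w) by field; rewrite gt_eqF.
by rewrite ler_piMr ?(ltW t_gt0)// ler_pdivrMr ?mul1r ?ltW.
Qed.

Lemma norm_dresid_le1 M x : `|dresid M x| <= 1.
Proof.
rewrite /dresid; case: ifPn => [_|]; first by rewrite normr1.
rewrite -ltNge => tw; have wp := lt_trans t_gt0 tw.
have u0 : 0 <= t / weight M x by rewrite divr_ge0 ?ltW.
have u1 : t / weight M x <= 1 by rewrite ler_pdivrMr// mul1r ltW.
case: ifPn => [_|].
  have a1 : 0 <= 1 - a by rewrite subr_ge0 ltW.
  rewrite ger0_norm; last exact: mulr_ge0.
  by apply: mulr_ile1 => //; rewrite gerBl.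
by rewrite -ltNge => Mx; rewrite -(weight_far (ltW Mx)) normrN ger0_norm.
Qed.

Lemma sqr_resid_le_max M x : 0 < Num.max M `|x| ->
  resid M x ^+ 2 <= t * (t / Num.max M `|x| ^+ 2).
Proof.
set m := Num.max _ _ => m0; have mw := weight_ge M x; rewrite -/m in mw.
rewrite -real_normK ?num_real//.
have -> : t * (t / m ^+ 2) = (t / m) ^+ 2 by field; rewrite gt_eqF.
rewrite ler_sqr ?nnegrE ?divr_ge0 ?(ltW t_gt0) ?(ltW m0)// ler_pdivlMr// residE.
case: ifPn => [wt|]; first by rewrite mulrC (le_trans mw).
rewrite -ltNge => tw; have wp := lt_trans t_gt0 tw.
rewrite normrM ger0_norm ?divr_ge0 ?(ltW t_gt0) ?(ltW wp)// -mulrA.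
by rewrite mulrAC ler_pdivrMr// ler_wpM2l ?(ltW t_gt0)// mulrC.
Qed.

End shrinkage_coordinate.

Section stein_shrinkage.
Context {R : realType}.
Variables (t a s : R).
Hypotheses (t_gt0 : 0 < t) (a_ge0 : 0 <= a) (a_lt1 : a < 1) (s_gt0 : 0 < s).

Lemma weight_near (M x : R) : 0 <= x <= M -> weight a M x = M `^ (2 - a) * x `^ a.
Proof. by move=> /andP[x0 xM]; rewrite /weight ger0_norm// max_l. Qed.

Lemma resid_big (M x : R) : weight a M x <= t ->
  resid t a M x = x /\ dresid t a M x = 1.
Proof. by move=> wt; rewrite residE// /dresid wt. Qed.

Lemma resid_far (M x : R) : 0 <= x -> t < x ^+ 2 -> M < x ->
  resid t a M x = t / x /\ dresid t a M x = - (t / x ^+ 2).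
Proof.
move=> x0 tx Mx; have xE : `|x| = x by rewrite ger0_norm.
have wE : weight a M x = x ^+ 2 by rewrite weight_far// xE ltW.
rewrite residE// /dresid wE leNgt tx /= xE leNgt Mx/=; split => //.
have xn0 : x != 0 by apply: contraTneq tx => ->; rewrite expr0n/= -leNgt ltW.
by field.
Qed.

Lemma resid_mid (M x : R) : 0 < x <= M -> t < weight a M x ->
  resid t a M x = t / M `^ (2 - a) * x `^ (1 - a) /\
  dresid t a M x = t / M `^ (2 - a) * ((1 - a) * x `^ (1 - a - 1)).
Proof.
move=> /andP[x0 xM] tw; have M0 := lt_le_trans x0 xM.
have xE : `|x| = x by rewrite ger0_norm ?ltW.
rewrite residE// /dresid leNgt tw /= xE xM weight_near ?(ltW x0)//.
have -> : 1 - a - 1 = - a by ring.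
have xp : 0 < x `^ a by rewrite powR_gt0.
have Mp : 0 < M `^ (2 - a) by rewrite powR_gt0.
have -> : x `^ (1 - a) = x / x `^ a.
  by rewrite powRB ?powRr1 ?(ltW x0)// gt_eqF// implybT.
by rewrite powRN; split; field; rewrite !gt_eqF.
Qed.

(** On x >= 0 there are three shapes. If M^2 <= t, resid is x up to sqrt t and t/x
    beyond. Otherwise it is x up to the point p where weight reaches t, then a
    multiple of x^(1-a) up to M, and t/x beyond; for a = 0 the weight is constant
    on [0, M], so there resid is linear up to M. *)
Lemma has_integral_stein_resid (m M : R) : 0 <= M ->
  has_integral `[0, +oo[ (stein s m (resid t a M) (dresid t a M)) 0.
Proof.
move=> M0.
have far q x : M <= q -> t <= q ^+ 2 -> q < x ->
    resid t a M x = t / x /\ dresid t a M x = - (t / x ^+ 2).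
  move=> Mq tq qx; have q0 := le_trans M0 Mq.
  apply: resid_far; [lra| |lra].
  by apply: le_lt_trans tq _; rewrite ltr_sqr ?nnegrE//; lra.
have [Mt|tM] := leP (M ^+ 2) t.
  (* The middle interval is empty: p = q = sqrt t. *)
  pose p := Num.sqrt t.
  have p0 : 0 < p by rewrite sqrtr_gt0.
  have p2 : p ^+ 2 = t by rewrite sqr_sqrtr ?ltW.
  have Mp : M <= p by rewrite -ler_sqr ?nnegrE ?p2// ltW.
  apply: (@has_integral_stein_pieces _ _ s_gt0 m p p 1 1 1 t) => //.
  - exact: ltW.
  - by rewrite powRr1 ?ltW.
  - by rewrite powRr1 ?(ltW p0)// -p2 mul1r; field; rewrite gt_eqF.
  - move=> x /andP[x0 xp]; rewrite mul1r; apply: resid_big.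
    apply: le_trans (weight_le _ _ _) _ => //.
    rewrite -p2 ler_sqr ?nnegrE ?le_max ?M0 ?(ltW p0)//.
    by rewrite ge_max Mp ger0_norm.
  - by move=> x /andP[px xp]; move: (lt_le_trans px xp); rewrite ltxx.
  - by move=> x; apply: far => //; rewrite p2.
have Mgt0 : 0 < M.
  by rewrite lt_neqAle M0 andbT eq_sym; apply: contraTneq tM => ->;
    rewrite expr0n/= -leNgt ltW.
have Mp : 0 < M `^ (2 - a) by rewrite powR_gt0.
have MM : M `^ (2 - a) * M `^ a = M ^+ 2 by rewrite mul_powRB_powR// powR2.
have [a0|an0] := eqVneq a 0.
  (* The middle interval is empty again: p = q = M. *)
  have wM x : 0 <= x <= M -> weight a M x = M ^+ 2.
    by move=> xM; rewrite weight_near// -MM a0 !powRr0.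
  apply: (@has_integral_stein_pieces _ _ s_gt0 m M M (t / M ^+ 2) 1 (t / M ^+ 2) t) => //.
  - exact: ltW.
  - by rewrite powRr1.
  - by rewrite powRr1//; field; rewrite gt_eqF.
  - move=> x x0M; have /andP[x0 xM] := x0M.
    rewrite residE// /dresid wM// leNgt tM/= ger0_norm// xM a0.
    by split=> //; rewrite subr0 mul1r.
  - by move=> x /andP[px xp]; move: (lt_le_trans px xp); rewrite ltxx.
  - by move=> x; apply: far => //; exact: ltW.
have a_gt0 : 0 < a by rewrite lt_neqAle eq_sym an0.
pose c := t / M `^ (2 - a).
have c0 : 0 < c by rewrite divr_gt0.
have cM : M `^ (2 - a) * c = t by rewrite /c; field; rewrite gt_eqF.
pose p := c `^ a^-1.
have p0 : 0 < p by rewrite powR_gt0.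
have pa : p `^ a = c by rewrite -powRrM mulVf// powRr1 ?ltW.
have pM : p <= M.
  have : p `^ a <= M `^ a.
    by rewrite pa ler_pdivrMr// mulrC MM ltW.
  apply: contraTT; rewrite -!ltNge => Mp'.
  by rewrite gt0_ltr_powR ?nnegrE// ltW.
apply: (@has_integral_stein_pieces _ _ s_gt0 m p M 1 (1 - a) c t) => //.
- exact: ltW.
- by rewrite mul1r -pa mulrC mul_powRB_powR ?powRr1 ?oner_eq0// ltW.
- have -> : c = t / (M `^ (1 - a) * M).
    rewrite /c -[X in _ = t / (_ * X)](powRr1 M0) -powRD; last first.
      by rewrite (gt_eqF Mgt0) implybT.
    by congr (_ / _ `^ _); ring.
  by field; rewrite !gt_eqF// powR_gt0.
- move=> x /andP[x0 xp]; rewrite mul1r; apply: resid_big.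
  rewrite weight_near ?x0 ?(le_trans xp)// -cM -pa ler_wpM2l ?powR_ge0//.
  by rewrite ge0_ler_powR ?nnegrE// ltW.
- move=> x /andP[px xM]; have x0 := lt_trans p0 px.
  apply: resid_mid; first by rewrite x0.
  rewrite weight_near ?xM ?(ltW x0)// -cM -pa ltr_pM2l//.
  by rewrite gt0_ltr_powR ?nnegrE// ltW.
- by move=> x; apply: far => //; exact: ltW.
Qed.


Section measurability.
Context d (T : measurableType d) (M f : T -> R).
Hypotheses (mM : measurable_fun setT M) (mf : measurable_fun setT f).

Let measurable_norm : measurable_fun setT (fun w => `|f w|).
Proof. exact: measurableT_comp. Qed.

(** Division is expressed by the real power -1, a measurable function. *)
Lemma measurable_divr_ge0 (g : T -> R) : measurable_fun setT g ->
  (forall w, 0 <= g w) -> measurable_fun setT (fun w => t / g w).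
Proof.
move=> mg g0; under eq_fun do rewrite -(powR_inv1 (g0 _)).
apply: measurable_funM => //.
exact: (measurableT_comp (measurable_powR _) mg).
Qed.

Lemma measurable_weight : measurable_fun setT (fun w => weight a (M w) (f w)).
Proof.
apply: measurable_funM.
  apply: (measurableT_comp (measurable_powR _)).
  exact: (measurable_maxr mM measurable_norm).
exact: (measurableT_comp (measurable_powR _) measurable_norm).
Qed.

Lemma measurable_shrink : measurable_fun setT (fun w => shrink t a (M w) (f w)).
Proof.
apply: measurable_funM => //.
have mw : measurable_fun setT (fun w => 1 - t / weight a (M w) (f w)).
  apply: measurable_funB => //.
  by apply: measurable_divr_ge0 => [|w]; [exact: measurable_weight|exact: weight_ge0].
exact: (measurable_maxr (@measurable_cst _ _ _ _ setT (0 : R)) mw).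
Qed.

Lemma measurable_resid : measurable_fun setT (fun w => resid t a (M w) (f w)).
Proof. by apply: measurable_funB => //; exact: measurable_shrink. Qed.

Lemma measurable_dresid : measurable_fun setT (fun w => dresid t a (M w) (f w)).
Proof.
apply: measurable_fun_ifT => //=.
  exact: measurable_fun_ler measurable_weight _.
apply: measurable_fun_ifT => //=.
- exact: measurable_fun_ler.
- apply: measurable_funM => //.
  by apply: measurable_divr_ge0 => [|w]; [exact: measurable_weight|exact: weight_ge0].
- apply: measurableT_comp => //.
  by apply: measurable_divr_ge0 => [|w]; [exact: measurable_funX|exact: sqr_ge0].
Qed.

End measurability.

Lemma stein_resid (m M : R) : 0 <= M ->
  (\int[normal_prob m s]_x ((x - m - resid t a M x) ^+ 2 +
      2 * s ^+ 2 * (dresid t a M x + 1))%:E =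
   \int[normal_prob m s]_x
      ((x - m) ^+ 2 + resid t a M x ^+ 2 + 2 * s ^+ 2)%:E)%E.
Proof.
move=> M0; apply: (@normal_stein_identity _ _ s_gt0 m t).
- exact: measurable_resid.
- exact: measurable_dresid.
- exact: resid_opp.
- exact: dresid_opp.
- exact: sqr_resid_le.
- exact: norm_dresid_le1.
- by move=> k; exact: has_integral_stein_resid.
Qed.

End stein_shrinkage.

(** * Separating one coordinate of a product measure *)

Section coordinates.
Context {R : realType}.
Implicit Types (n : nat).

Definition insert_tnth n (i : 'I_n.+1) (x : R) (v : vec R n) : vec R n.+1 :=
  [tuple if unlift i j is Some k then tnth v k else x | j < n.+1].

Lemma tnth_insert n (i : 'I_n.+1) x (v : vec R n) : tnth (insert_tnth i x v) i = x.
Proof. by rewrite tnth_mktuple unlift_none. Qed.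

Lemma tnth_insert_lift n (i : 'I_n.+1) x (v : vec R n) j :
  tnth (insert_tnth i x v) (lift i j) = tnth v j.
Proof. by rewrite tnth_mktuple liftK. Qed.

Lemma insert_tnth0 n (x : R) (v : vec R n) :
  insert_tnth ord0 x v = cons_pair (x, v).
Proof.
apply: eq_from_tnth => j; case: (unliftP ord0 j) => [k ->|->].
  by rewrite tnth_insert_lift tnthS.
by rewrite tnth_insert.
Qed.

Lemma insert_tnth_lift n (j : 'I_n.+1) (x y : R) (w : vec R n) :
  insert_tnth (lift ord0 j) x (cons_pair (y, w)) =
  cons_pair (y, insert_tnth j x w).
Proof.
apply: eq_from_tnth => k; case: (unliftP (lift ord0 j) k) => [l ->|->]; last first.
  by rewrite tnth_insert tnthS tnth_insert.
rewrite tnth_insert_lift; case: (unliftP ord0 l) => [l' ->|->].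
  rewrite tnthS; have -> : lift (lift ord0 j) (lift ord0 l') = lift ord0 (lift j l').
    by apply: val_inj; rewrite /= /bump; case: leqP => /=; case: leqP => /=; lia.
  by rewrite tnthS tnth_insert_lift.
by have -> : lift (lift ord0 j) ord0 = ord0 by apply: val_inj.
Qed.

Lemma measurable_insert n (i : 'I_n.+1) :
  measurable_fun [set: measurableTypeR R * vec R n]
    (fun p => insert_tnth i p.1 p.2).
Proof.
apply/measurable_fun_tnthP => j; case: (unliftP i j) => [k ->|->].
  rewrite (_ : _ \o _ = (fun v => tnth v k) \o snd); last first.
    by apply/funext => p /=; rewrite tnth_insert_lift.
  exact: (measurableT_comp (@measurable_tnth _ _ n k) measurable_snd).
rewrite (_ : _ \o _ = fst)//.
by apply/funext => p /=; rewrite tnth_insert.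
Qed.

Local Open Scope ereal_scope.

Lemma integral_tuple_probS n (mu : 'I_n.+1 -> probability (measurableTypeR R) R)
    (F : vec R n.+1 -> \bar R) :
  measurable_fun setT F -> (forall z, 0 <= F z) ->
  \int[tuple_prob mu]_z F z =
  \int[mu ord0]_x \int[tuple_prob (fun k => mu (lift ord0 k))]_v
     F (cons_pair (x, v)).
Proof.
move=> mF F0.
have mFc : measurable_fun setT (F \o @cons_pair R n).
  exact: (measurableT_comp mF (@measurable_cons_pair R _)).
rewrite /= (ge0_integral_pushforward (@measurable_cons_pair R n))//.
rewrite preimage_setT (fubini_tonelli1 (F \o @cons_pair R n))//.
by move=> p; exact: F0.
Qed.

(** tuple_prob is a product built from the first coordinate on, and this lets any
    coordinate be integrated first. By induction on the dimension: inserting at a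
    later place commutes with prepending the first coordinate, so Tonelli's theorem
    is used only for the first coordinate. *)
Lemma integral_tuple_prob_insert n (i : 'I_n.+1)
    (mu : 'I_n.+1 -> probability (measurableTypeR R) R)
    (F : vec R n.+1 -> \bar R) :
  measurable_fun setT F -> (forall z, 0 <= F z) ->
  \int[tuple_prob mu]_z F z =
  \int[tuple_prob (fun k => mu (lift i k))]_v \int[mu i]_x F (insert_tnth i x v).
Proof.
elim: n i mu F => [|n IH] i mu F mF F0; rewrite integral_tuple_probS//.
  rewrite (ord1 i) (fubini_tonelli (fun p => F (cons_pair p)))//.
    by apply: eq_integral => v _; apply: eq_integral => x _; rewrite insert_tnth0.
  exact: (measurableT_comp mF (@measurable_cons_pair R _)).
have mFi k : measurable_fun [set: measurableTypeR R * vec R n.+1]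
    (fun p => F (insert_tnth k p.1 p.2)).
  exact: (measurableT_comp mF (measurable_insert k)).
have [j ->|->] := unliftP ord0 i; last first.
  rewrite (fubini_tonelli (fun p => F (cons_pair p)))//.
    by apply: eq_integral => v _; apply: eq_integral => x _; rewrite insert_tnth0.
  exact: (measurableT_comp mF (@measurable_cons_pair R _)).
rewrite integral_tuple_probS; last 2 first.
- exact: (measurable_fun_fubini_tonelli_G _ (mFi _)).
- by move=> v; apply: integral_ge0.
have -> : lift (lift ord0 j) ord0 = ord0 by apply: val_inj.
have -> : (fun k => mu (lift (lift ord0 j) (lift ord0 k))) =
          (fun k => mu (lift ord0 (lift j k))).
  apply/funext => k; congr mu; apply: val_inj.
  by rewrite /= /bump; case: leqP => /=; case: leqP => /=; lia.
apply: eq_integral => y _.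
rewrite (IH j (fun k => mu (lift ord0 k)) (fun v => F (cons_pair (y, v)))).
- apply: eq_integral => w _; apply: eq_integral => x _.
  by rewrite insert_tnth_lift.
- apply: (measurableT_comp mF).
  exact: (measurableT_comp (@measurable_cons_pair _ _) (measurable_pair1 _)).
- by [].
Qed.

Definition add_vec n (u v : vec R n) : vec R n :=
  [tuple (tnth u i + tnth v i)%R | i < n].

Lemma measurable_add_vec n d (T : measurableType d) (f g : T -> vec R n) :
  measurable_fun setT f -> measurable_fun setT g ->
  measurable_fun setT (fun x => add_vec (f x) (g x)).
Proof.
move=> mf mg; apply/measurable_fun_tnthP => i.
rewrite (_ : _ \o _ = fun x => (tnth (f x) i + tnth (g x) i)%R); last first.
  by apply/funext => x /=; rewrite tnth_mktuple.
by apply: measurable_funD; apply: (measurableT_comp (@measurable_tnth _ _ _ _)).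
Qed.

Lemma add_vec_insert n (i : 'I_n.+1) (x y : R) (v w : vec R n) :
  add_vec (insert_tnth i x v) (insert_tnth i y w) =
  insert_tnth i (x + y)%R (add_vec v w).
Proof.
apply: eq_from_tnth => j; rewrite tnth_mktuple.
by case: (unliftP i j) => [k ->|->]; rewrite ?tnth_insert ?tnth_insert_lift ?tnth_mktuple.
Qed.

(** Writing N(theta, s^2 I) as the law of theta + w makes the measure independent
    of theta, so that Tonelli's theorem applies to theta and w jointly. *)
Lemma normal_vec_prob_shift n (s : R) (theta : vec R n) (F : vec R n -> \bar R) :
  (0 < s)%R -> measurable_fun setT F -> (forall z, 0 <= F z) ->
  \int[normal_vec_prob theta s]_z F z =
  \int[tuple_prob (fun=> normal_prob 0 s)]_w F (add_vec theta w).
Proof.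
move=> s0; elim: n theta F => [|n IH] theta F mF F0.
  by apply: eq_integral => w _; congr F; rewrite [LHS]tuple0 [RHS]tuple0.
have mFc : measurable_fun setT (F \o @cons_pair R n).
  exact: (measurableT_comp mF (@measurable_cons_pair R _)).
have mFt : measurable_fun setT (fun w => F (add_vec theta w)).
  apply: (measurableT_comp mF).
  exact: (@measurable_add_vec n.+1 _ _ (fun=> theta) id).
apply: etrans (integral_tuple_probS _ mF F0) _.
apply: etrans _ (esym (integral_tuple_probS
  (fun=> normal_prob 0 s) mFt (fun=> F0 _))).
pose theta' : vec R n := [tuple tnth theta (lift ord0 k) | k < n].
have nuE : tuple_prob (fun k : 'I_n => normal_prob (tnth theta (lift ord0 k)) s) =
           normal_vec_prob theta' s.
  rewrite /normal_vec_prob; congr tuple_prob.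
  by apply/funext => k; rewrite tnth_mktuple.
rewrite nuE.
pose G (x : R) := \int[normal_vec_prob theta' s]_v F (cons_pair (x, v)).
have mG : measurable_fun [set: measurableTypeR R] G.
  by apply: (measurable_fun_fubini_tonelli_F _ mFc) => p; exact: F0.
have G0 x : 0 <= G x by apply: integral_ge0.
have {1}-> : tnth theta ord0 = (0 + tnth theta ord0)%R by rewrite add0r.
rewrite (normal_prob_shift s0 0 (tnth theta ord0) mG G0).
apply: eq_integral => x _.
rewrite /G IH; last 2 first.
- apply: (measurableT_comp mF).
  exact: (measurableT_comp (@measurable_cons_pair _ _) (measurable_pair1 _)).
- by [].
apply: eq_integral => v _; congr F; rewrite -!insert_tnth0.
have -> : theta = insert_tnth ord0 (tnth theta ord0) theta'.
  apply: eq_from_tnth => k; case: (unliftP ord0 k) => [l ->|->].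
    by rewrite tnth_insert_lift tnth_mktuple.
  by rewrite tnth_insert.
by rewrite add_vec_insert tnth_insert addrC.
Qed.

End coordinates.

(** * The lower bound: Bayes risk under a normal prior *)

Section bayes_line.
Context {R : realType}.
Local Notation mu := (@lebesgue_measure R).

(** The integral is a supremum over the simple functions below f, and the constant
    c is one of them. *)
Lemma probability_integral_ge_cst d (T : measurableType d)
    (P : probability T R) (c : R) (f : T -> \bar R) :
  0 <= c -> (forall x, (c%:E <= f x)%E) -> (c%:E <= \int[P]_x f x)%E.
Proof.
move=> c0 cf; have f0 x : (0 <= f x)%E by apply: le_trans (cf x); rewrite lee_fin.
rewrite ge0_integralTE//; apply: ereal_sup_ubound.
exists (cst_nnsfun T (NngNum c0)) => //=.
have := sintegral_EFin_cst P setT (NngNum c0).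
by rewrite patch_setT [X in (_ * X)%E]probability_setT mule1.
Qed.

(** After centring, the symmetry x -> -x gives twice the integral as the integral
    of (e - x)^2 + (e + x)^2 = 2 e^2 + 2 x^2, at least twice the variance. *)
Lemma normal_mse_ge (s m e : R) : 0 < s ->
  ((s ^+ 2)%:E <= \int[normal_prob m s]_x ((e - x) ^+ 2)%:E)%E.
Proof.
move=> s0.
have mQ c : measurable_fun [set: R] (fun x : R => ((c - x) ^+ 2)%:E).
  by apply/measurable_EFinP; apply: measurable_funX; exact: measurable_funB.
have Q0 (c x : R) : (0 <= ((c - x) ^+ 2)%:E)%E by rewrite lee_fin sqr_ge0.
rewrite -[X in normal_prob X s](add0r m) (normal_prob_shift s0)//.
under eq_integral => x _.
  have -> : (e - (x + m)) ^+ 2 = (e - m - x) ^+ 2 by ring.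
  over.
move: (e - m) => {e m} e.
have mQp (c : R) : measurable_fun [set: R]
    (fun x : R => ((c - x) ^+ 2)%:E * (normal_pdf 0 s x)%:E)%E.
  by apply: emeasurable_funM => //; exact: measurable_EFin_normal_pdf.
have Qp0 (c x : R) : (0 <= ((c - x) ^+ 2)%:E * (normal_pdf 0 s x)%:E)%E.
  by rewrite mule_ge0// lee_fin normal_pdf_ge0.
rewrite /= integral_normal_prob//.
have IE : (\int[mu]_x (((- e - x) ^+ 2)%:E * (normal_pdf 0 s x)%:E) =
           \int[mu]_x (((e - x) ^+ 2)%:E * (normal_pdf 0 s x)%:E))%E.
  rewrite -(ge0_integral_opp (mQp e))//; apply: eq_integral => x _.
  rewrite (normal_pdf_opp s0) oppr0.
  by have -> : (e - - x) ^+ 2 = (- e - x) ^+ 2 by ring.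
rewrite leNgt; apply/negP => Is.
have := lteD Is Is; rewrite -{1}IE -ge0_integralD//; [|exact: mQp..].
rewrite ltNge => /negP; apply.
rewrite -(second_moment0 s0) -ge0_integralD//; last 4 first.
- by move=> x _; rewrite lee_fin mulr_ge0 ?sqr_ge0 ?normal_pdf_ge0.
- apply/measurable_EFinP; apply: measurable_funM => //.
  exact: measurable_normal_pdf.
- by move=> x _; rewrite lee_fin mulr_ge0 ?sqr_ge0 ?normal_pdf_ge0.
- apply/measurable_EFinP; apply: measurable_funM => //.
  exact: measurable_normal_pdf.
have mxx : measurable_fun [set: R] (fun x : R => (x ^+ 2 * normal_pdf 0 s x)%:E).
  apply/measurable_EFinP; apply: measurable_funM => //.
  exact: measurable_normal_pdf.
apply: ge0_le_integral => //.
- by move=> x _; rewrite -EFinD lee_fin addr_ge0// mulr_ge0 ?sqr_ge0 ?normal_pdf_ge0.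
- by apply: emeasurable_funD; exact: mxx.
- by apply: emeasurable_funD; exact: mQp.
- move=> x _; rewrite -!EFinM -!EFinD lee_fin -!mulrDl.
  rewrite ler_wpM2r ?normal_pdf_ge0//.
  by have := sqr_ge0 e; nra.
Qed.

Lemma normal_peakE (s : R) : 0 < s ->
  normal_peak s = (s * Num.sqrt (pi *+ 2))^-1.
Proof.
move=> s0; rewrite /normal_peak -mulrnAr sqrtrM ?sqr_ge0//.
by rewrite sqrtr_sqr gtr0_norm.
Qed.

(** Completing the square: the joint density of (theta, Z) is the marginal density
    of Z times the posterior density of theta, which is normal with mean
    (r^2/v) x and variance s^2 r^2 / v. *)
Lemma normal_pdf_bayes (s r x t : R) : 0 < s -> 0 < r ->
  let v := s ^+ 2 + r ^+ 2 in
  normal_pdf t s x * normal_pdf 0 r t =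
  normal_pdf 0 (Num.sqrt v) x *
  normal_pdf (r ^+ 2 / v * x) (s * r / Num.sqrt v) t.
Proof.
move=> s0 r0 v.
have v0 : 0 < v by rewrite addr_gt0// exprn_gt0.
have S0 : 0 < Num.sqrt v by rewrite sqrtr_gt0.
have S2 : Num.sqrt v ^+ 2 = v by rewrite sqr_sqrtr// ltW.
have rho0 : 0 < s * r / Num.sqrt v by rewrite divr_gt0// mulr_gt0.
rewrite !normal_pdfE ?gt_eqF// !normal_peakE// /normal_fun.
have pi0 : Num.sqrt (pi *+ 2) != 0 :> R.
  by rewrite gt_eqF// sqrtr_gt0 mulrn_wgt0// pi_gt0.
rewrite mulrACA -expRD [RHS]mulrACA -expRD; congr (_ * expR _).
  by field; rewrite pi0 !gt_eqF.
rewrite expr_div_n S2 /v; field.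
by rewrite !gt_eqF// -/v.
Qed.

(** Exchanging the order of integration conditions on the observation x = t + y.
    The inner integral is then the mean squared error of the constant f x under the
    posterior, at least the posterior variance. *)
Lemma bayes_risk_ge (s r : R) (f : R -> R) : 0 < s -> 0 < r ->
  measurable_fun [set: R] f ->
  ((s ^+ 2 * r ^+ 2 / (s ^+ 2 + r ^+ 2))%:E <=
   \int[normal_prob 0 r]_t \int[normal_prob 0 s]_y ((f (t + y) - t) ^+ 2)%:E)%E.
Proof.
move=> s0 r0 mf; pose v := s ^+ 2 + r ^+ 2.
have v0 : 0 < v by rewrite addr_gt0// exprn_gt0.
have S0 : 0 < Num.sqrt v by rewrite sqrtr_gt0.
have rho0 : 0 < s * r / Num.sqrt v by rewrite divr_gt0// mulr_gt0.
have mft t : measurable_fun [set: R] (fun x => ((f x - t) ^+ 2)%:E).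
  by apply/measurable_EFinP; apply: measurable_funX; exact: measurable_funB.
have inner t : (\int[normal_prob 0 s]_y ((f (t + y) - t) ^+ 2)%:E =
    \int[mu]_x (((f x - t) ^+ 2)%:E * (normal_pdf t s x)%:E))%E.
  have ft0 x : (0 <= ((f x - t) ^+ 2)%:E)%E by rewrite lee_fin sqr_ge0.
  apply: etrans _ (integral_normal_prob s t (mft t) ft0).
  have := normal_prob_shift s0 0 t (mft t) ft0; rewrite add0r => ->.
  by apply: eq_integral => y _; rewrite [t + y]addrC.
pose Q (p : measurableTypeR R * measurableTypeR R) : \bar R :=
  (((f p.2 - p.1) ^+ 2)%:E * (normal_pdf p.1 s p.2)%:E)%E.
have Q0 p : (0 <= Q p)%E by rewrite mule_ge0// lee_fin ?sqr_ge0 ?normal_pdf_ge0.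
have mQ : measurable_fun setT Q.
  apply: emeasurable_funM; apply/measurable_EFinP.
    apply: measurable_funX; apply: measurable_funB => //.
    exact: (measurableT_comp mf measurable_snd).
  rewrite (_ : (fun p => _) = normal_pdf 0 s \o
      (fun p : measurableTypeR R * measurableTypeR R => p.2 - p.1)).
    apply: (measurableT_comp (measurable_normal_pdf 0 s)).
    exact: measurable_funB.
  apply/funext => p /=; rewrite -(normal_pdf_shift s0 0 (p.2 - p.1) p.1).
  by rewrite add0r subrK.
pose H (p : measurableTypeR R * measurableTypeR R) : \bar R :=
  (Q p * (normal_pdf 0 r p.1)%:E)%E.
have H0 p : (0 <= H p)%E by rewrite mule_ge0// lee_fin normal_pdf_ge0.
have mH : measurable_fun setT H.
  apply: emeasurable_funM => //; apply/measurable_EFinP.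
  exact: (measurableT_comp (measurable_normal_pdf 0 r) measurable_fst).
have -> : (\int[normal_prob 0 r]_t \int[normal_prob 0 s]_y ((f (t + y) - t) ^+ 2)%:E =
           \int[mu]_t \int[mu]_x H (t, x))%E.
  under eq_integral do rewrite inner.
  rewrite integral_normal_prob; last 2 first.
  - exact: (measurable_fun_fubini_tonelli_F Q).
  - by move=> t; apply: integral_ge0 => x _; exact: (Q0 (t, x)).
  apply: eq_integral => t _; rewrite -ge0_integralZr//.
  - exact: (measurableT_comp mQ (measurable_pair1 _)).
  - by move=> x _; exact: (Q0 (t, x)).
  - by rewrite lee_fin normal_pdf_ge0.
rewrite (fubini_tonelli H)//.
set rho := s * r / Num.sqrt v in rho0.
have rho2 : rho ^+ 2 = s ^+ 2 * r ^+ 2 / v.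
  by rewrite /rho expr_div_n exprMn sqr_sqrtr// ltW.
rewrite -/v -rho2.
apply: (@le_trans _ _ (\int[mu]_x ((rho ^+ 2)%:E * (normal_pdf 0 (Num.sqrt v) x)%:E))%E).
  rewrite ge0_integralZl//.
  - by rewrite integral_normal_pdf mule1.
  - exact: measurable_EFin_normal_pdf.
  - by move=> x _; rewrite lee_fin normal_pdf_ge0.
  - by rewrite lee_fin sqr_ge0.
apply: ge0_le_integral => //.
- by move=> x _; rewrite mule_ge0// lee_fin ?sqr_ge0 ?normal_pdf_ge0.
- by apply: emeasurable_funM => //; exact: measurable_EFin_normal_pdf.
- exact: (measurable_fun_fubini_tonelli_G H).
move=> x _.
have -> : (\int[mu]_t H (t, x) =
    \int[normal_prob (r ^+ 2 / v * x) rho]_t ((f x - t) ^+ 2)%:E *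
    (normal_pdf 0 (Num.sqrt v) x)%:E)%E.
  have mfx : measurable_fun [set: R] (fun t => ((f x - t) ^+ 2)%:E).
    by apply/measurable_EFinP; apply: measurable_funX; exact: measurable_funB.
  rewrite integral_normal_prob//; last by move=> t; rewrite lee_fin sqr_ge0.
  rewrite -ge0_integralZr//.
  - apply: eq_integral => t _; rewrite /H /Q/= -!EFinM; congr EFin.
    by rewrite -mulrA (normal_pdf_bayes x t s0 r0) -/v -/rho; ring.
  - by apply: emeasurable_funM => //; exact: measurable_EFin_normal_pdf.
  - by move=> t _; rewrite mule_ge0// lee_fin ?sqr_ge0 ?normal_pdf_ge0.
  - by rewrite lee_fin normal_pdf_ge0.
rewrite lee_wpmul2r ?lee_fin ?normal_pdf_ge0//.
exact: normal_mse_ge.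
Qed.

End bayes_line.

Section bayes_vector.
Context {R : realType}.
Implicit Types (n : nat).

Lemma measurable_tnth_comp d (T : measurableType d) n (i : 'I_n) (f : T -> vec R n) :
  measurable_fun setT f ->
  measurable_fun setT (fun x => tnth (f x) i : measurableTypeR R).
Proof. by move=> mf; exact: (measurableT_comp (@measurable_tnth _ _ n i) mf). Qed.

Lemma measurable_sqr_err d (T : measurableType d) n (f g : T -> vec R n) :
  measurable_fun setT f -> measurable_fun setT g ->
  forall i, measurable_fun setT (fun x => ((tnth (f x) i - tnth (g x) i) ^+ 2)%:E).
Proof.
move=> mf mg i; apply/measurable_EFinP; apply: measurable_funX.
by apply: measurable_funB; exact: measurable_tnth_comp.
Qed.

Local Open Scope ereal_scope.

(** With theta' and v the other coordinates of theta and of the noise, the i-th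
    component of delta is a function f of theta_i + w_i alone, to which
    bayes_risk_ge applies. *)
Lemma bayes_coordinate n (i : 'I_n.+1) (s r : R) (delta : vec R n.+1 -> vec R n.+1) :
  (0 < s)%R -> (0 < r)%R -> measurable_fun setT delta ->
  (s ^+ 2 * r ^+ 2 / (s ^+ 2 + r ^+ 2))%:E <=
  \int[tuple_prob (fun=> normal_prob 0 r)]_theta
    \int[tuple_prob (fun=> normal_prob 0 s)]_w
      ((tnth (delta (add_vec theta w)) i - tnth theta i) ^+ 2)%:E.
Proof.
move=> s0 r0 mdelta.
pose H (p : vec R n.+1 * vec R n.+1) : \bar R :=
  ((tnth (delta (add_vec p.1 p.2)) i - tnth p.1 i) ^+ 2)%:E.
have H0 p : 0 <= H p by rewrite lee_fin sqr_ge0.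
have mH : measurable_fun setT H.
  apply: (@measurable_sqr_err _ _ _ (fun p => delta (add_vec p.1 p.2)) fst) => //.
  apply: (measurableT_comp mdelta).
  exact: (@measurable_add_vec _ _ _ _ fst snd).
have v0 : (0 <= s ^+ 2 * r ^+ 2 / (s ^+ 2 + r ^+ 2))%R.
  by apply: divr_ge0; [apply: mulr_ge0|apply: addr_ge0]; exact: sqr_ge0.
change ((s ^+ 2 * r ^+ 2 / (s ^+ 2 + r ^+ 2))%:E <=
  \int[tuple_prob (fun=> normal_prob 0 r)]_theta
    \int[tuple_prob (fun=> normal_prob 0 s)]_w H (theta, w)).
pose G theta : \bar R := \int[tuple_prob (fun=> normal_prob 0 s)]_w H (theta, w).
have mG : measurable_fun setT G by exact: (measurable_fun_fubini_tonelli_F H).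
have G0 z : 0 <= G z by apply: integral_ge0.
have -> := integral_tuple_prob_insert i (fun=> normal_prob 0 r) mG G0.
apply: probability_integral_ge_cst => // theta'.
pose K (q : measurableTypeR R * vec R n) : \bar R :=
  \int[normal_prob 0 s]_y H (insert_tnth i q.1 theta', insert_tnth i y q.2).
have K0 q : 0 <= K q by apply: integral_ge0.
have mK : measurable_fun setT K.
  pose f1 (p : (measurableTypeR R * vec R n) * measurableTypeR R) :=
    insert_tnth i p.1.1 theta'.
  pose f2 (p : (measurableTypeR R * vec R n) * measurableTypeR R) :=
    insert_tnth i p.2 p.1.2.
  have mf1 : measurable_fun setT f1.
    apply: (measurableT_comp (measurable_insert i)
      (_ : measurable_fun setT (fun p => (p.1.1, theta')))).
    apply: measurable_fun_pair => //.
    exact: (measurableT_comp measurable_fst measurable_fst).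
  have mf2 : measurable_fun setT f2.
    apply: (measurableT_comp (measurable_insert i)
      (_ : measurable_fun setT (fun p => (p.2, p.1.2)))).
    apply: measurable_fun_pair => //.
    exact: (measurableT_comp measurable_snd measurable_fst).
  apply: (measurable_fun_fubini_tonelli_F (fun p => H (f1 p, f2 p))).
    exact: (measurableT_comp mH (measurable_fun_pair mf1 mf2)).
  by move=> p; exact: H0.
have GE t : G (insert_tnth i t theta') =
    \int[tuple_prob (fun=> normal_prob 0 s)]_v K (t, v).
  apply: (integral_tuple_prob_insert i (fun=> normal_prob 0 s)
    (F := fun w => H (insert_tnth i t theta', w))) => //.
  exact: (measurableT_comp mH (measurable_pair1 _)).
have -> : \int[normal_prob 0 r]_t G (insert_tnth i t theta') =
    \int[normal_prob 0 r]_t \int[tuple_prob (fun=> normal_prob 0 s)]_v K (t, v).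
  by apply: eq_integral => t _; exact: GE.
have -> := fubini_tonelli (m1 := normal_prob 0 r)
  (m2 := tuple_prob (fun=> normal_prob 0 s)) K mK K0.
apply: probability_integral_ge_cst => // v.
pose f (x : R) : R := tnth (delta (insert_tnth i x (add_vec theta' v))) i.
have mf : measurable_fun [set: measurableTypeR R] f.
  apply: measurable_tnth_comp; apply: (measurableT_comp mdelta).
  exact: (measurableT_comp (measurable_insert i) (measurable_pair2 _)).
apply: le_trans (bayes_risk_ge s0 r0 mf) _.
rewrite le_eqVlt; apply/orP; left; apply/eqP.
apply: eq_integral => t _; apply: eq_integral => y _.
by rewrite /H/= add_vec_insert tnth_insert.
Qed.

Lemma loss_sumE n (s : R) (a theta : vec R n) :
  (loss s a theta)%:E =
  \sum_(i < n) ((s ^+ 2)^-1%:E * ((tnth a i - tnth theta i) ^+ 2)%:E).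
Proof. by rewrite sumEFin; congr EFin; apply: eq_bigr => i _; rewrite mulrC. Qed.

Lemma loss_ge0 n (s : R) (a theta : vec R n) : (0 <= loss s a theta)%R.
Proof. by apply: sumr_ge0 => i _; rewrite divr_ge0 ?sqr_ge0. Qed.

Lemma measurable_loss d (T : measurableType d) n (s : R) (f g : T -> vec R n) :
  measurable_fun setT f -> measurable_fun setT g ->
  measurable_fun setT (fun x => (loss s (f x) (g x))%:E).
Proof.
move=> mf mg; under eq_fun do rewrite loss_sumE.
apply: emeasurable_sum => i; apply: emeasurable_funM => //.
exact: measurable_sqr_err.
Qed.

Lemma bayes_loss_ge n (s r : R) (delta : vec R n.+1 -> vec R n.+1) :
  (0 < s)%R -> (0 < r)%R -> measurable_fun setT delta ->
  (n.+1%:R * (r ^+ 2 / (s ^+ 2 + r ^+ 2)))%:E <=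
  \int[tuple_prob (fun=> normal_prob 0 r)]_theta
    \int[tuple_prob (fun=> normal_prob 0 s)]_w
      (loss s (delta (add_vec theta w)) theta)%:E.
Proof.
move=> s0 r0 mdelta.
pose H i (p : vec R n.+1 * vec R n.+1) : \bar R :=
  ((tnth (delta (add_vec p.1 p.2)) i - tnth p.1 i) ^+ 2)%:E.
have H0 i p : 0 <= H i p by rewrite lee_fin sqr_ge0.
have mH i : measurable_fun setT (H i).
  apply: (@measurable_sqr_err _ _ _ (fun p => delta (add_vec p.1 p.2)) fst) => //.
  apply: (measurableT_comp mdelta).
  exact: (@measurable_add_vec _ _ _ _ fst snd).
have c0 : (0 <= (s ^+ 2)^-1)%R by rewrite invr_ge0 sqr_ge0.
have mHt i theta : measurable_fun setT (fun w => H i (theta, w)).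
  exact: (measurableT_comp (mH i) (measurable_pair1 _)).
pose G i theta : \bar R := \int[tuple_prob (fun=> normal_prob 0 s)]_w H i (theta, w).
have mG i : measurable_fun setT (G i) by exact: (measurable_fun_fubini_tonelli_F (H i)).
have G0 i z : 0 <= G i z by apply: integral_ge0.
have inner theta : \int[tuple_prob (fun=> normal_prob 0 s)]_w
      (loss s (delta (add_vec theta w)) theta)%:E =
    \sum_(i < n.+1) ((s ^+ 2)^-1%:E * G i theta).
  under eq_integral do rewrite loss_sumE.
  rewrite ge0_integral_sum//.
  - apply: eq_bigr => i _; apply: ge0_integralZl => //; first exact: mHt.
    by move=> w _; exact: (H0 i (theta, w)).
  - by move=> i; apply: emeasurable_funM => //; exact: mHt.
  - by move=> i w _; apply: mule_ge0; [rewrite lee_fin|exact: (H0 i (theta, w))].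
have -> : \int[tuple_prob (fun=> normal_prob 0 r)]_theta
    \int[tuple_prob (fun=> normal_prob 0 s)]_w
      (loss s (delta (add_vec theta w)) theta)%:E =
    \int[tuple_prob (fun=> normal_prob 0 r)]_theta
      \sum_(i < n.+1) ((s ^+ 2)^-1%:E * G i theta).
  by apply: eq_integral => theta _; exact: inner.
rewrite ge0_integral_sum//; last 2 first.
- by move=> i; apply: emeasurable_funM.
- by move=> i w _; rewrite mule_ge0.
have -> : (n.+1%:R * (r ^+ 2 / (s ^+ 2 + r ^+ 2)))%:E = \sum_(i < n.+1)
    ((s ^+ 2)^-1%:E * (s ^+ 2 * r ^+ 2 / (s ^+ 2 + r ^+ 2))%:E) :> \bar R.
  have E : ((s ^+ 2)^-1 * (s ^+ 2 * r ^+ 2 / (s ^+ 2 + r ^+ 2)) =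
            r ^+ 2 / (s ^+ 2 + r ^+ 2))%R.
    field; rewrite (gt_eqF s0) andbT gt_eqF// addr_gt0// exprn_gt0//.
  by rewrite -EFinM E sumEFin sumr_const card_ord mulr_natl.
apply: lee_sum => i _; rewrite ge0_integralZl//.
by rewrite lee_wpmul2l//; exact: bayes_coordinate.
Qed.

(** The supremum of the risk dominates its average under every normal prior. *)
Lemma minimax_lower_bound n (s B : R) (delta : vec R n.+1 -> vec R n.+1) :
  (0 < s)%R -> measurable_fun setT delta ->
  (forall theta, \int[normal_vec_prob theta s]_z (loss s (delta z) theta)%:E <= B%:E) ->
  (n.+1%:R <= B)%R.
Proof.
move=> s0 mdelta hB; rewrite leNgt; apply/negP => Bn.
have B0 : (0 <= B)%R.
  rewrite -lee_fin; apply: le_trans (hB [tuple of nseq n.+1 0%R]).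
  by apply: integral_ge0 => z _; rewrite lee_fin loss_ge0.
(* The prior variance for which n.+1 r^2 / (s^2 + r^2) already exceeds B. *)
pose r2 := ((B * s ^+ 2 + 1) / (n.+1%:R - B))%R.
have r20 : (0 < r2)%R.
  apply: divr_gt0; last by rewrite subr_gt0.
  by rewrite ltr_wpDl// mulr_ge0// sqr_ge0.
pose r := Num.sqrt r2.
have r0 : (0 < r)%R by rewrite sqrtr_gt0.
have rE : (r ^+ 2 = r2)%R by rewrite sqr_sqrtr ?ltW.
have := bayes_loss_ge s0 r0 mdelta; rewrite leNgt => /negP; apply.
apply: (@le_lt_trans _ _ B%:E); last first.
  rewrite lte_fin mulrA ltr_pdivlMr; last by rewrite addr_gt0 ?exprn_gt0.
  have : ((n.+1%:R - B) * r2 = B * s ^+ 2 + 1)%R.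
    by rewrite mulrC divfK// subr_eq0 gt_eqF.
  by rewrite rE; lra.
have <- := integral_probability_cst
  (tuple_prob (fun _ : 'I_n.+1 => normal_prob 0 r)) B%:E.
apply: ge0_le_integral => //.
- by move=> theta _; apply: integral_ge0 => w _; rewrite lee_fin loss_ge0.
- apply: (measurable_fun_fubini_tonelli_F
    (fun p => (loss s (delta (add_vec p.1 p.2)) p.1)%:E)).
    apply: measurable_loss => //; apply: (measurableT_comp mdelta).
    exact: (@measurable_add_vec _ _ _ _ fst snd).
  by move=> p; rewrite lee_fin loss_ge0.
- move=> theta _.
  have mL : measurable_fun setT (fun z => (loss s (delta z) theta)%:E).
    exact: measurable_loss.
  have L0 z : 0 <= (loss s (delta z) theta)%:E by rewrite lee_fin loss_ge0.
  have <- := normal_vec_prob_shift theta s0 mL L0.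
  exact: hB.
Qed.

End bayes_vector.

(** * The upper bound: the risk of the shrinkage estimator *)

Section upper_bound.
Context {R : realType}.
Implicit Types (n : nat).

Definition delete_tnth n (i : 'I_n.+1) (z : vec R n.+1) : vec R n :=
  [tuple tnth z (lift i k) | k < n].

Lemma delete_insert n (i : 'I_n.+1) (x : R) (v : vec R n) :
  delete_tnth i (insert_tnth i x v) = v.
Proof. by apply: eq_from_tnth => k; rewrite tnth_mktuple tnth_insert_lift. Qed.

Lemma max_abs_ge0 n (z : vec R n) : 0 <= max_abs z.
Proof. exact: bigmax_ge_id. Qed.

Lemma le_max_abs n (z : vec R n) i : `|tnth z i| <= max_abs z.
Proof. exact: (le_bigmax _ (fun j => `|tnth z j|)). Qed.

Lemma le_max_delete n (i j : 'I_n.+1) (z : vec R n.+1) : j != i ->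
  `|tnth z j| <= max_abs (delete_tnth i z).
Proof.
case: (unliftP i j) => [k -> _|->]; last by rewrite eqxx.
by have := le_max_abs (delete_tnth i z) k; rewrite tnth_mktuple.
Qed.

Lemma max_abs_delete n (i : 'I_n.+1) (z : vec R n.+1) :
  Num.max (max_abs (delete_tnth i z)) `|tnth z i| = max_abs z.
Proof.
apply/eqP; rewrite eq_le ge_max le_max_abs andbT; apply/andP; split.
  apply: bigmax_le; first exact: max_abs_ge0.
  by move=> k _; rewrite tnth_mktuple le_max_abs.
apply: bigmax_le; first by rewrite le_max max_abs_ge0.
move=> j _; rewrite le_max; have [->|ji] := eqVneq j i; first by rewrite lexx orbT.
by rewrite le_max_delete.
Qed.

Lemma measurable_max_abs n : measurable_fun setT (@max_abs R n).
Proof.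
rewrite /max_abs; elim: (index_enum _) => [|j r IH].
  under eq_fun do rewrite big_nil; exact: measurable_cst.
under eq_fun do rewrite big_cons.
have mj : measurable_fun setT (fun z : vec R n => `|tnth z j|).
  exact: (measurableT_comp (@normr_measurable R setT)
    (@measurable_tnth _ (measurableTypeR R) n j)).
exact: (measurable_maxr mj IH).
Qed.

Lemma measurable_delete n (i : 'I_n.+1) : measurable_fun setT (@delete_tnth n i).
Proof.
apply/measurable_fun_tnthP => k.
rewrite (_ : _ \o _ = (fun z => tnth z (lift i k))).
  exact: (@measurable_tnth _ (measurableTypeR R) n.+1 (lift i k)).
by apply/funext => z /=; rewrite tnth_mktuple.
Qed.

Variables (n : nat) (s a : R).
Hypotheses (n_ge2 : (2 <= n)%N) (s_gt0 : 0 < s) (a_ge0 : 0 <= a).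
Hypothesis a_lt : a < (n.+1%:R - 2) / (n.+1%:R - 1).

Let d : R := n.+1%:R.
Let c := (d - 2) - a * (d - 1).
Let t := s ^+ 2 * (2 * c / d).

Let d_ge3 : 3 <= d. Proof. by rewrite /d ler_nat. Qed.

Let c_gt0 : 0 < c.
Proof.
have d1 : 0 < d - 1 by have := d_ge3; lra.
by move: a_lt; rewrite -/d ltr_pdivlMr// /c; lra.
Qed.

Let a_lt1 : a < 1.
Proof.
have d1 : 0 < d - 1 by have := d_ge3; lra.
apply: lt_le_trans a_lt _; rewrite -/d ler_pdivrMr//; lra.
Qed.

Let t_gt0 : 0 < t.
Proof.
have d0 : 0 < d by have := d_ge3; lra.
by rewrite /t mulr_gt0 ?exprn_gt0// divr_gt0// mulr_gt0.
Qed.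

Let resid_at (z : vec R n.+1) i := resid t a (max_abs (delete_tnth i z)) (tnth z i).
Let dresid_at (z : vec R n.+1) i := dresid t a (max_abs (delete_tnth i z)) (tnth z i).

Lemma tnth_shrinkage (z : vec R n.+1) i :
  tnth (shrinkage_estimator s a z) i = tnth z i - resid_at z i.
Proof.
rewrite tnth_mktuple /resid_at /resid opprB addrCA subrr addr0 /shrink.
congr (Num.max 0 (1 - _) * _).
rewrite /weight max_abs_delete /t /c /d -(mulrA n.+1%:R) (invfM n.+1%:R).
by rewrite !mulrA.
Qed.

(** The pointwise inequality that makes Stein's unbiased estimate of the risk at
    most d. Writing u = t/m^2 in the case m^2 > t, the bounds K_i^2 <= t u and
    D_i >= (1-a) u - (2-a) u [coordinate i is strictly largest] sum up to
    d t u and c u, and t = 2 s^2 c / d. *)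
Lemma sum_sqr_resid_le (z : vec R n.+1) :
  \sum_i resid_at z i ^+ 2 <= \sum_i 2 * s ^+ 2 * dresid_at z i.
Proof.
pose m := max_abs z.
have d0 : 0 < d by have := d_ge3; lra.
have s2 : 0 < s ^+ 2 by rewrite exprn_gt0.
have wm i : weight a (max_abs (delete_tnth i z)) (tnth z i) <= m ^+ 2.
  by apply: le_trans (weight_le _ _ _) _ => //; rewrite max_abs_delete.
have [mt|tm] := leP (m ^+ 2) t.
  apply: ler_sum => i _.
  have [-> ->] : resid_at z i = tnth z i /\ dresid_at z i = 1.
    by apply: resid_big => //; exact: le_trans (wm i) _.
  rewrite mulr1; apply: (@le_trans _ _ t).
    apply: le_trans mt; rewrite -real_normK ?num_real//.
    by rewrite ler_sqr ?nnegrE ?max_abs_ge0// le_max_abs.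
  rewrite /t mulrC ler_pM2r// ler_pdivrMr//.
  have : 0 <= a * (d - 1) by rewrite mulr_ge0//; have := d_ge3; lra.
  by rewrite /c; lra.
have m0 : 0 < m.
  rewrite lt_neqAle max_abs_ge0 andbT eq_sym; apply: contraTneq tm => ->.
  by rewrite expr0n/= -leNgt ltW.
pose u := t / m ^+ 2.
have u0 : 0 < u by rewrite divr_gt0// exprn_gt0.
have u1 : u <= 1 by rewrite ler_pdivrMr ?exprn_gt0// mul1r ltW.
(* Coordinate i is the only one of maximal modulus. *)
pose far i := max_abs (delete_tnth i z) < `|tnth z i|.
have Dge i : (1 - a) * u - (2 - a) * u * (far i)%:R <= dresid_at z i.
  rewrite /dresid_at /dresid; case: ifPn => [_|].
    have fu : 0 <= (2 - a) * u * (far i)%:R.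
      by rewrite mulr_ge0 ?ler0n// mulr_ge0 ?(ltW u0)// subr_ge0; have := a_lt1; lra.
    have : 0 <= a * u by rewrite mulr_ge0 ?(ltW u0).
    lra.
  rewrite -ltNge => tw; have w0 := lt_trans t_gt0 tw.
  rewrite /far; case: leP => xM.
    rewrite mulr0 subr0 ler_pM2l ?subr_gt0// /u.
    by rewrite ler_pM2l// lef_pV2 ?posrE ?exprn_gt0.
  rewrite mulr1 /u /m -(max_abs_delete i) (max_idPr (ltW xM)).
  by rewrite real_normK ?num_real//; lra.
(* Each of two strictly largest coordinates would exceed the other. *)
have far1 : \sum_i (far i)%:R <= 1 :> R.
  have [/existsP[i0 fi0]|/existsPn nofar] := boolP [exists i, far i].
    rewrite (bigD1 i0)//= fi0 big1 ?addr0// => i ii0.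
    suff /negbTE -> : ~~ far i by [].
    rewrite /far -leNgt; apply: (@le_trans _ _ (max_abs (delete_tnth i0 z))).
      exact: le_max_delete.
    by apply: le_trans (ltW fi0) _; apply: le_max_delete; rewrite eq_sym.
  by rewrite big1 ?ler01// => i _; rewrite (negbTE (nofar i)).
have Ksum : \sum_i resid_at z i ^+ 2 <= d * (t * u).
  rewrite mulr_natl -[X in _ *+ X](card_ord n.+1) -sumr_const.
  apply: ler_sum => i _; rewrite /resid_at /u /m -(max_abs_delete i).
  by apply: sqr_resid_le_max => //; rewrite max_abs_delete.
apply: le_trans Ksum _; rewrite -mulr_sumr.
have Dsum : u * c <= \sum_i dresid_at z i.
  apply: (@le_trans _ _ (\sum_(i < n.+1) ((1 - a) * u - (2 - a) * u * (far i)%:R))).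
    rewrite sumrB sumr_const card_ord -mulr_natl -/d -mulr_sumr.
    have : (2 - a) * u * (\sum_i (far i)%:R) <= (2 - a) * u.
      by rewrite ler_piMr// mulr_ge0 ?(ltW u0)//; have := a_lt1; lra.
    by rewrite /c; lra.
  exact: ler_sum.
have -> : d * (t * u) = 2 * s ^+ 2 * (u * c).
  by rewrite /t; field; rewrite gt_eqF.
by rewrite ler_pM2l// mulr_gt0.
Qed.

Lemma measurable_shrinkage_estimator :
  measurable_fun setT (@shrinkage_estimator R n.+1 s a).
Proof.
apply/measurable_fun_tnthP => i.
rewrite (_ : _ \o _ = (fun z => tnth z i - resid_at z i)); last first.
  by apply/funext => z /=; rewrite tnth_shrinkage.
apply: measurable_funB; first exact: measurable_tnth.
apply: measurable_resid; last exact: measurable_tnth.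
exact: (measurableT_comp (@measurable_max_abs n) (measurable_delete i)).
Qed.

Variable theta : vec R n.+1.
Local Notation P := (normal_vec_prob theta s).

Let mcoord i : measurable_fun setT (fun z : vec R n.+1 => tnth z i : measurableTypeR R).
Proof. exact: measurable_tnth. Qed.

Let mmax i : measurable_fun setT (fun z : vec R n.+1 => max_abs (delete_tnth i z)).
Proof. exact: (measurableT_comp (@measurable_max_abs n) (measurable_delete i)). Qed.

Let mresid i : measurable_fun setT (resid_at ^~ i).
Proof. exact: (measurable_resid t a (mmax i) (mcoord i)). Qed.

Let mdresid i : measurable_fun setT (dresid_at ^~ i).
Proof. exact: (measurable_dresid t a (mmax i) (mcoord i)). Qed.

Let mdiff i : measurable_fun setT (fun z : vec R n.+1 => tnth z i - tnth theta i).
Proof. by apply: measurable_funB; [exact: mcoord|exact: measurable_cst]. Qed.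

Let merr i : measurable_fun setT (fun z : vec R n.+1 => (tnth z i - tnth theta i) ^+ 2).
Proof. by apply: measurable_funX; exact: mdiff. Qed.

Let lhs i z : R :=
  (tnth z i - tnth theta i - resid_at z i) ^+ 2 + 2 * s ^+ 2 * (dresid_at z i + 1).
Let rhs i z : R :=
  (tnth z i - tnth theta i) ^+ 2 + resid_at z i ^+ 2 + 2 * s ^+ 2.

Let mlhs i : measurable_fun setT (fun z => (lhs i z)%:E).
Proof.
apply/measurable_EFinP; apply: measurable_funD.
  by apply: measurable_funX; apply: measurable_funB; [exact: mdiff|exact: mresid].
apply: measurable_funM; first exact: measurable_cst.
by apply: measurable_funD; [exact: mdresid|exact: measurable_cst].
Qed.

Let mrhs i : measurable_fun setT (fun z => (rhs i z)%:E).
Proof.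
apply/measurable_EFinP; apply: measurable_funD; last exact: measurable_cst.
by apply: measurable_funD; [exact: merr|apply: measurable_funX; exact: mresid].
Qed.

Let s2_ge0 : 0 <= 2 * s ^+ 2. Proof. by rewrite mulr_ge0// sqr_ge0. Qed.

Let lhs_ge0 i z : (0 <= (lhs i z)%:E)%E.
Proof.
rewrite lee_fin addr_ge0 ?sqr_ge0// mulr_ge0//.
have := norm_dresid_le1 t_gt0 a_ge0 a_lt1 (max_abs (delete_tnth i z)) (tnth z i).
by rewrite ler_norml => /andP[h _]; rewrite -lerBlDr sub0r.
Qed.

Let rhs_ge0 i z : (0 <= (rhs i z)%:E)%E.
Proof. by rewrite lee_fin !addr_ge0 ?sqr_ge0. Qed.

(** With the other coordinates fixed, resid_at and dresid_at depend on them only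
    through their largest modulus, and stein_resid applies on the line. *)
Lemma coordinate_stein i :
  (\int[P]_z (lhs i z)%:E = \int[P]_z (rhs i z)%:E)%E.
Proof.
have -> := integral_tuple_prob_insert i
  (fun k => normal_prob (tnth theta k) s) (mlhs i) (lhs_ge0 i).
have -> := integral_tuple_prob_insert i
  (fun k => normal_prob (tnth theta k) s) (mrhs i) (rhs_ge0 i).
apply: eq_integral => v _.
apply: etrans (etrans _
  (stein_resid t_gt0 a_ge0 a_lt1 s_gt0 (tnth theta i) (max_abs_ge0 v))) _.
  apply: eq_integral => x _.
  by rewrite /lhs /resid_at /dresid_at delete_insert tnth_insert.
apply: eq_integral => x _.
by rewrite /rhs /resid_at delete_insert tnth_insert.
Qed.

Lemma coordinate_variance i :
  (\int[P]_z ((tnth z i - tnth theta i) ^+ 2)%:E = (s ^+ 2)%:E)%E.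
Proof.
have mF : measurable_fun setT
    (fun z : vec R n.+1 => ((tnth z i - tnth theta i) ^+ 2)%:E).
  by apply/measurable_EFinP; exact: merr.
have F0 z : (0 <= ((tnth z i - tnth theta i) ^+ 2)%:E)%E by rewrite lee_fin sqr_ge0.
have -> := integral_tuple_prob_insert i
  (fun k => normal_prob (tnth theta k) s) mF F0.
rewrite -[RHS](integral_probability_cst
  (tuple_prob (fun k => normal_prob (tnth theta (lift i k)) s))).
apply: eq_integral => v _; rewrite -(second_moment s_gt0 (tnth theta i)).
by apply: eq_integral => x _; rewrite tnth_insert.
Qed.

(** Adding the identities coordinate_stein over i and bounding the sum of the D_i
    from below by sum_sqr_resid_le leaves E[sum_i K_i^2] + 2 d s^2 on both sides;
    it is finite because K_i^2 <= t, and is cancelled. *)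
Lemma shrinkage_risk_le :
  (\int[P]_z (loss s (shrinkage_estimator s a z) theta)%:E <= d%:E)%E.
Proof.
have s2 : 0 < s ^+ 2 by rewrite exprn_gt0.
pose L z : R := \sum_i (tnth z i - tnth theta i - resid_at z i) ^+ 2.
pose K z : R := \sum_i resid_at z i ^+ 2.
have L0 z : 0 <= L z by apply: sumr_ge0 => i _; exact: sqr_ge0.
have K0 z : 0 <= K z by apply: sumr_ge0 => i _; exact: sqr_ge0.
have mL : measurable_fun setT L.
  apply: measurable_sum => i; apply: measurable_funX.
  by apply: measurable_funB; [exact: mdiff|exact: mresid].
have mK : measurable_fun setT K.
  by apply: measurable_sum => i; apply: measurable_funX; exact: mresid.
have -> : (\int[P]_z (loss s (shrinkage_estimator s a z) theta)%:E =
           (s ^+ 2)^-1%:E * \int[P]_z (L z)%:E)%E.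
  rewrite -ge0_integralZl//; last by rewrite lee_fin invr_ge0 ltW.
  - apply: eq_integral => z _; rewrite -EFinM; congr EFin.
    rewrite /L mulr_sumr; apply: eq_bigr => i _.
    by rewrite tnth_shrinkage mulrC; congr (_ * _ ^+ 2); ring.
  - exact/measurable_EFinP.
  - by move=> z _; rewrite lee_fin.
have KE : (\int[P]_z (K z)%:E \is a fin_num)%E.
  rewrite ge0_fin_numE; last by apply: integral_ge0 => z _; rewrite lee_fin.
  apply: (@le_lt_trans _ _ (\int[P]_z (d * t)%:E)%E); last first.
    by rewrite (integral_probability_cst P) ltry.
  apply: ge0_le_integral => //.
  - by move=> z _; rewrite lee_fin.
  - exact/measurable_EFinP.
  - move=> z _; rewrite lee_fin mulr_natl -[X in _ *+ X](card_ord n.+1) -sumr_const.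
    by apply: ler_sum => i _; exact: sqr_resid_le.
(* C is the contribution of the constants added to make the integrands
   nonnegative. *)
pose C := (d * (2 * s ^+ 2))%:E.
have total : (\int[P]_z (L z)%:E + (\int[P]_z (K z)%:E + C) <=
              (d * s ^+ 2)%:E + (\int[P]_z (K z)%:E + C))%E.
  have mKC : measurable_fun setT (fun z => ((K z)%:E + C)%E).
    by apply: emeasurable_funD => //; exact/measurable_EFinP.
  have C0 : (0 <= C)%E by rewrite lee_fin mulr_ge0.
  have intKC : (\int[P]_z ((K z)%:E + C) = \int[P]_z (K z)%:E + C)%E.
    rewrite ge0_integralD//.
    - by rewrite (integral_probability_cst P).
    - by move=> z _; rewrite lee_fin.
    - exact/measurable_EFinP.
  apply: (@le_trans _ _ (\int[P]_z (\sum_(i < n.+1) (lhs i z)%:E))%E).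
    rewrite -intKC -ge0_integralD//; last 3 first.
    - by move=> z _; rewrite lee_fin.
    - exact/measurable_EFinP.
    - by move=> z _; rewrite adde_ge0// lee_fin.
    apply: ge0_le_integral => //.
    - by move=> z _; rewrite !adde_ge0// lee_fin.
    - by apply: emeasurable_funD => //; exact/measurable_EFinP.
    - by apply: emeasurable_sum => i; exact: mlhs.
    move=> z _; rewrite sumEFin /C -!EFinD lee_fin big_split/= lerD2l.
    under [leRHS]eq_bigr do rewrite mulrDr mulr1.
    rewrite big_split/= [X in _ <= _ + X]sumr_const card_ord -[X in _ <= _ + X]mulr_natl.
    by rewrite lerD2r; exact: sum_sqr_resid_le.
  rewrite ge0_integral_sum//.
  under eq_bigr do rewrite coordinate_stein.
  rewrite -ge0_integral_sum//.
  have <- : (\int[P]_z (\sum_(i < n.+1) ((tnth z i - tnth theta i) ^+ 2)%:E) =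
             (d * s ^+ 2)%:E)%E.
    rewrite ge0_integral_sum//.
    - under eq_bigr do rewrite coordinate_variance.
      by rewrite sumEFin sumr_const card_ord mulr_natl.
    - by move=> i; apply/measurable_EFinP; exact: merr.
    - by move=> i z _; rewrite lee_fin sqr_ge0.
  rewrite -intKC -ge0_integralD//; last 3 first.
  - by move=> z _; apply: sume_ge0 => i _; rewrite lee_fin sqr_ge0.
  - by apply: emeasurable_sum => i; apply/measurable_EFinP; exact: merr.
  - by move=> z _; rewrite adde_ge0// lee_fin.
  rewrite le_eqVlt; apply/orP; left; apply/eqP.
  apply: eq_integral => z _; rewrite !sumEFin /C -!EFinD; congr EFin.
  by rewrite /rhs !big_split/= sumr_const card_ord
    -(mulr_natl (2 * s ^+ 2)) addrA.
move: total; rewrite leeD2rE; last by rewrite fin_numD KE.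
move=> LE; apply: (@le_trans _ _ ((s ^+ 2)^-1%:E * (d * s ^+ 2)%:E)%E).
  by apply: lee_wpmul2l => //; rewrite lee_fin invr_ge0 ltW.
by rewrite -EFinM mulrC mulfK// gt_eqF.
Qed.

End upper_bound.

(** * Minimaxity *)

(** The risk depends on the probability space only through the law of Z. *)
Lemma risk_normal_vec (R : realType) (n : nat) (sigma : R) (disp : measure_display)
    (T : measurableType disp) (P : vec R n -> probability T R)
    (Z : {mfun T >-> vec R n})
    (hZ : forall (theta : vec R n) (A : set (vec R n)), measurable A ->
      distribution (P theta) Z A = normal_vec_prob theta sigma A)
    (delta : vec R n -> vec R n) (theta : vec R n) : measurable_fun setT delta ->
  risk P Z sigma delta theta =
  (\int[normal_vec_prob theta sigma]_z (loss sigma (delta z) theta)%:E)%E.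
Proof.
move=> mdelta; rewrite /risk unlock.
have mL : measurable_fun setT (fun z => (loss sigma (delta z) theta)%:E).
  exact: measurable_loss.
have L0 z : (0 <= (loss sigma (delta z) theta)%:E)%E by rewrite lee_fin loss_ge0.
apply: etrans (esym (ge0_integral_distribution (P := P theta) Z mL L0)) _.
by apply: eq_measure_integral => A mA _; exact: hZ.
Qed.

Theorem mainTheorem2 (R : realType) (d : nat) (sigma alpha : R)
    (disp : measure_display) (T : measurableType disp)
    (P : vec R d -> probability T R) (Z : {mfun T >-> vec R d})
    (hd : (3 <= d)%N) (hsigma : 0 < sigma)
    (hZ : forall (theta : vec R d) (A : set (vec R d)), measurable A ->
      distribution (P theta) Z A = normal_vec_prob theta sigma A)
    (halpha0 : 0 <= alpha) (halpha1 : alpha < (d%:R - 2) / (d%:R - 1)) :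
  minimax P Z sigma (shrinkage_estimator sigma alpha).
Proof.
case: d P Z hd hZ halpha1 => [//|n] P Z hd hZ halpha1.
have mdelta := @measurable_shrinkage_estimator R n sigma alpha.
split=> // delta' mdelta'.
apply: (@le_trans _ _ (n.+1%:R%:E)).
  apply: ge_ereal_sup => _ [theta _ <-].
  by rewrite (risk_normal_vec hZ)//; exact: shrinkage_risk_le.
have risk_le theta : (risk P Z sigma delta' theta <= max_risk P Z sigma delta')%E.
  by apply: ereal_sup_ubound; exists theta.
have risk_ge0 theta : (0 <= risk P Z sigma delta' theta)%E.
  rewrite (risk_normal_vec hZ)//; apply: integral_ge0 => z _.
  by rewrite lee_fin loss_ge0.
case E : (max_risk P Z sigma delta') risk_le => [B| |] risk_le.
- rewrite lee_fin; apply: (minimax_lower_bound hsigma mdelta') => theta.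
  by rewrite -(risk_normal_vec hZ).
- exact: leey.
- pose theta0 : vec R n.+1 := [tuple 0 | i < n.+1].
  by have := le_trans (risk_ge0 theta0) (risk_le theta0).
Qed.
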